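(* There exist $\mathfrak{c}$-many mutually inequivalent planar embeddings of the Knaster accordion $K$; that is, there is a collection $\Phi$ of planar embeddings of $K$ with $|\Phi|=\mathfrak{c}$ such that any two distinct members of $\Phi$ are inequivalent.
   Context: $\mathfrak{c}$ denotes the cardinality of the set of real numbers. The Knaster $V\Lambda$-continuum (Knaster accordion) $K\subset[0,1]\times[0,1]\subset\mathbb{R}^2$ is constructed as follows. A ''$V$'' (resp. ''$\Lambda$'') is an arc that is the union of two straight segments, with a common end (its vertex) on the line $y=0$ (resp. $y=1$), and whose two endpoints lie on the line $y=1$ (resp. $y=0$). Step 1: draw the $V$ with vertex $(1/2,0)$ and endpoints $(1/3,1)$ and $(2/3,1)$. Step $n\ge 2$: let $\Delta_n$ be the set of the $2^{n-1}$ quadrilaterals contained in $[0,1]\times[0,1]$, with bottom side on $y=0$ and top side on $y=1$, whose left and right sides are each one of $\{0\}\times[0,1]$, $\{1\}\times[0,1]$, or a maximal straight segment of a $V$ or $\Lambda$ drawn in a preceding step (the two sides not belonging to the same $V$ or $\Lambda$), and whose interiors contain no points of the $V$'s and $\Lambda$'s drawn in preceding steps. If $n$ is even, in each member of $\Delta_n$ draw a $\Lambda$ whose vertex is the midpoint of the top side and whose two endpoints trisect the bottom side; if $n$ is odd, in each member of $\Delta_n$ draw a $V$ whose vertex is the midpoint of the bottom side and whose two endpoints trisect the top side. $K$ is the closure of the union of all $V$'s and $\Lambda$'s drawn in all steps. A planar embedding of a continuum $X$ is a homeomorphism of $X$ onto a subset of the plane $\mathbb{R}^2$. Two planar embeddings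 $\varphi,\psi$ of $X$ are equivalent if there is a homeomorphism of the plane onto itself mapping $\varphi(X)$ onto $\psi(X)$; otherwise they are inequivalent. *)

(* Defs.v *)
From mathcomp Require Import all_boot all_order all_algebra.
From mathcomp Require Import all_classical all_reals all_analysis.
Set Implicit Arguments.
Unset Strict Implicit.
Unset Printing Implicit Defensive.
Import Order.TTheory GRing.Theory Num.Theory.
Import numFieldNormedType.Exports.
Local Open Scope classical_set_scope.
Local Open Scope ring_scope.

Section KnasterAccordion.
Context {R : realType}.

Local Notation plane := (R * R)%type.

(* A side [s] stands for the straight segment from (s.1, 0) to (s.2, 1);
   [abscissa s y] is the abscissa of its point at height [y]. *)
Definition side : Type := (R * R)%type.

Definition abscissa (s : side) (y : R) : R := (1 - y) * s.1 + y * s.2.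

Definition segment (s : side) : set plane :=
  [set p | 0 <= p.2 <= 1 /\ p.1 = abscissa s p.2].

(* A "V" or a "Lambda" is the pair (left leg, right leg) of its two maximal
   straight segments. *)
Definition zigzag : Type := (side * side)%type.

Definition zigzag_set (F : zigzag) : set plane := segment F.1 `|` segment F.2.

Definition is_leg (F : zigzag) (s : side) : Prop := s = F.1 \/ s = F.2.

Definition zigzags_set (D : set zigzag) : set plane :=
  \bigcup_(F in D) zigzag_set F.

(* [quadrilateral q] is the quadrilateral with left side [q.1] and right side
   [q.2], when [q.1.1 < q.2.1] (bottom side) and [q.1.2 < q.2.2] (top side). *)
Definition quadrilateral (q : side * side) : set plane :=
  [set p | 0 <= p.2 <= 1 /\ abscissa q.1 p.2 <= p.1 <= abscissa q.2 p.2].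

Definition unit_square : set plane :=
  [set p | 0 <= p.1 <= 1 /\ 0 <= p.2 <= 1].

Definition allowed_side (D : set zigzag) (s : side) : Prop :=
  [\/ s = (0, 0), s = (1, 1) | exists2 F, D F & is_leg F s].

(* The set Delta_n, as a function of the set [D] of all the V's and Lambda's
   drawn in the steps preceding step n. *)
Definition Delta (D : set zigzag) : set (side * side) :=
  [set q | [/\ q.1.1 < q.2.1 /\ q.1.2 < q.2.2,
               quadrilateral q `<=` unit_square,
               allowed_side D q.1 /\ allowed_side D q.2,
               ~ (exists2 F, D F & is_leg F q.1 /\ is_leg F q.2)
             & (quadrilateral q)° `&` zigzags_set D = set0]].

Definition V_in (q : side * side) : zigzag :=
  let v := (q.1.1 + q.2.1) / 2 in
  let w := q.2.2 - q.1.2 in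
  ((v, q.1.2 + w / 3), (v, q.1.2 + 2 * w / 3)).

Definition Lambda_in (q : side * side) : zigzag :=
  let v := (q.1.2 + q.2.2) / 2 in
  let w := q.2.1 - q.1.1 in
  ((q.1.1 + w / 3, v), (q.1.1 + 2 * w / 3, v)).

(* All the V's and Lambda's drawn in steps 1, ..., n. *)
Fixpoint drawn (n : nat) : set zigzag :=
  if n is m.+1 then
    if m == 0%N then [set ((2^-1, 3^-1), (2^-1, 2 / 3))]
    else drawn m `|`
         (if odd m.+1 then V_in else Lambda_in) @` Delta (drawn m)
  else set0.

Definition knaster_accordion : set plane :=
  closure (\bigcup_n zigzags_set (drawn n)).

End KnasterAccordion.

Arguments knaster_accordion R : clear implicits.

Definition homeomorphism (T U : topologicalType) (f : T -> U) : Prop :=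
  exists g : U -> T,
    [/\ cancel f g, cancel g f, continuous f & continuous g].

Definition onto_range (T U : Type) (f : T -> U) (x : T) : set_type (range f) :=
  exist _ (f x) (mem_set (imageT f x)).

(* The subset [range phi] of the plane carries the subspace topology. *)
Definition planar_embedding (R : realType) (X : topologicalType)
    (phi : X -> R * R) : Prop :=
  homeomorphism (onto_range phi : X -> set_type (range phi)).

Definition equivalent_embeddings (R : realType) (X : topologicalType)
    (phi psi : X -> R * R) : Prop :=
  exists2 h : R * R -> R * R,
    homeomorphism h & h @` range phi = range psi.

(* Main.v *)
(* The accordion is a Cantor family of segments, glued in pairs at the vertices
   of the V's and Lambda's, and these vertices are its cut points.  The gaps
   bordering the rightmost quadrilaterals cut it into a sequence of blocks,
   which shrink to the side {1} x [0,1]; consecutive blocks share a vertex, a V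
   and a Lambda alternately.  As only one point is shared, each block can be
   embedded with either orientation, by an affine map fixing its two shared
   vertices, which gives an embedding for every sequence of signs.

   At a vertex v the accordion accumulates on each of the two legs from one side
   only.  Call v facing when the two free sides of its legs can be joined by
   arbitrarily short paths near v in the complement.  All vertices are facing,
   except those shared by two blocks of opposite orientations.  A homeomorphism
   of the plane which maps one embedded copy onto another preserves the
   non-facing cut points and the betweenness given by separation, hence maps the
   n-th one to the n-th one.  The V's among them converge to (1,0) and the
   Lambda's to (1,1), so by continuity the V/Lambda patterns of the two copies
   eventually agree, once they share infinitely many V's.  It remains to encode
   a real number in such a pattern so that each of its bits, one per rational,
   is repeated infinitely often. *)
Require Import Defs.
From mathcomp Require Import all_boot all_order all_algebra.
From mathcomp Require Import all_classical all_reals all_analysis.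
From mathcomp Require Import zify ring lra.
Set Implicit Arguments.
Unset Strict Implicit.
Unset Printing Implicit Defensive.
Import Order.TTheory GRing.Theory Num.Theory.
Import numFieldNormedType.Exports.
Local Open Scope classical_set_scope.
Local Open Scope ring_scope.

(** * Quadrilaterals and points of the accordion *)

Section Sides.
Context {R : realType}.
Implicit Types (s t : @side R) (q : @side R * @side R) (p : R * R).

(** A homeomorphism of the plane may reverse orientation, so the sign of a single block cannot be
    read off its image; a change of sign between neighbours can. The test for such a change has to
    be topological, although legs and their free sides are metric notions: [facing] recovers them
    from small connected subsets of the copy and from separation. The vertices inside a block are
    facing because the whole block undergoes a single affine map. The number and order of the sign
    changes must not depend on the encoded real, or the n-th ones of two copies would not carry the
    same bit. Hence one change is made in each pair of consecutive joins, and the bit only chooses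
    which of the two. Bits are compared through limits alone, so a finite disagreement would go
    unseen: this is why each bit must recur. The conditions defining [Delta] are awkward to iterate.
    They are traded for binary words: a word names a quadrilateral, and the accordion becomes the
    set of points covered at every level. *)

Definition sle s t := s.1 <= t.1 /\ s.2 <= t.2.
Definition slt s t := s.1 < t.1 /\ s.2 < t.2.

Definition pick_side (d : bool) q : side := if d then q.2 else q.1.

Lemma sle_refl s : sle s s. Proof. by split. Qed.

Lemma sltW s t : slt s t -> sle s t.
Proof. by case=> h1 h2; split; apply: ltW. Qed.

Lemma sle_trans t s u : sle s t -> sle t u -> sle s u.
Proof. by case=> h1 h2 [h3 h4]; split; [apply: le_trans h3|apply: le_trans h4]. Qed.

Lemma abscissa_le s t y : 0 <= y <= 1 -> sle s t -> abscissa s y <= abscissa t y.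
Proof.
by case/andP=> y0 y1 [h1 h2]; rewrite lerD ?ler_wpM2l // subr_ge0.
Qed.

Lemma abscissa_lt s t y : 0 <= y <= 1 -> slt s t -> abscissa s y < abscissa t y.
Proof.
case/andP=> y0 y1 [h1 h2]; have := ltW h1; have := ltW h2.
have [->|ny] := eqVneq y 0; first by rewrite /abscissa; lra.
by move=> *; rewrite ler_ltD ?ler_wpM2l ?ltr_pM2l ?subr_ge0 // lt_neqAle eq_sym ny.
Qed.

Lemma abscissa0 s : abscissa s 0 = s.1. Proof. by rewrite /abscissa; lra. Qed.
Lemma abscissa1 s : abscissa s 1 = s.2. Proof. by rewrite /abscissa; lra. Qed.

Definition draw (n : nat) q : zigzag := (if odd n.+1 then V_in else Lambda_in) q.

Definition child n (d : bool) q : side * side :=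
  let F := draw n q in if d then (F.2, q.2) else (q.1, F.1).

(* A word lists the choices (left or right of the zigzag drawn at each step)
   leading to a quadrilateral, most recent choice first. *)
Fixpoint quad (u : seq bool) : @side R * @side R :=
  if u is d :: v then child (size v) d (quad v) else ((0, 0), (1, 1)).

(** The zigzag drawn in [quad u] at step [(size u).+1], thought of as a hole: no point of the
    accordion lies strictly between its legs ([accordion_gap]). *)
Definition gap u : zigzag := draw (size u) (quad u).

Lemma quad_cons d u :
  quad (d :: u) = if d then ((gap u).2, (quad u).2) else ((quad u).1, (gap u).1).
Proof. by []. Qed.

(* The height of the vertices of the zigzags of step [n.+1]. *)
Definition apex (n : nat) : R := (~~ odd n.+1)%:R.

Lemma draw_bounds n q : slt q.1 q.2 ->
  [/\ slt q.1 (draw n q).1, sle (draw n q).1 (draw n q).2, slt (draw n q).2 q.2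
    & forall y, abscissa (draw n q).2 y - abscissa (draw n q).1 y =
       (if odd n.+1 then y * (q.2.2 - q.1.2) else (1 - y) * (q.2.1 - q.1.1)) / 3].
Proof.
case: q => [[a b] [c d]] [/= h1 h2]; rewrite /draw /=; case: (~~ odd n);
  split; rewrite /sle /slt /abscissa /=; try (by split; lra);
  by move=> y; field.
Qed.

Lemma quad_lt u : slt (quad u).1 (quad u).2.
Proof.
elim: u => [|d u IH]; first by split => /=; lra.
have [h1 h2 h3 _] := draw_bounds (size u) IH.
by rewrite quad_cons; case: d.
Qed.

Lemma gap_gt u : slt (quad u).1 (gap u).1.
Proof. by have [] := draw_bounds (size u) (quad_lt u). Qed.

Lemma gap_le u : sle (gap u).1 (gap u).2.
Proof. by have [] := draw_bounds (size u) (quad_lt u). Qed.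

Lemma gap_lt u : slt (gap u).2 (quad u).2.
Proof. by have [] := draw_bounds (size u) (quad_lt u). Qed.

Lemma gap_width u y : abscissa (gap u).2 y - abscissa (gap u).1 y =
  (if odd (size u).+1 then y * ((quad u).2.2 - (quad u).1.2)
   else (1 - y) * ((quad u).2.1 - (quad u).1.1)) / 3.
Proof. by have [] := draw_bounds (size u) (quad_lt u). Qed.

Lemma gap_abscissa_eq u y :
  (abscissa (gap u).1 y == abscissa (gap u).2 y) = (y == apex (size u)).
Proof.
have [h1 h2] := quad_lt u; have := gap_width u y; rewrite /apex.
case: (odd (size u).+1) => /= h; apply/eqP/eqP => e; first 1 last.
- by rewrite e in h *; lra.
- nra.
- by rewrite e in h *; lra.
- nra.
Qed.

Lemma gap_abscissa_lt u y : 0 <= y <= 1 -> y != apex (size u) ->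
  abscissa (gap u).1 y < abscissa (gap u).2 y.
Proof.
by move=> hy ny; rewrite lt_neqAle gap_abscissa_eq ny abscissa_le //; apply: gap_le.
Qed.

Lemma apexP n : apex n = 0 \/ apex n = 1.
Proof. by rewrite /apex; case: (odd _); [left|right]. Qed.

Lemma apex_ge0 n : 0 <= apex n <= 1.
Proof. by case: (apexP n) => ->; apply/andP; split; lra. Qed.

Lemma quad_cat v u :
  sle (quad u).1 (quad (v ++ u)).1 /\ sle (quad (v ++ u)).2 (quad u).2.
Proof.
elim: v => [|d v [IH1 IH2]]; first by split; apply: sle_refl.
rewrite cat_cons quad_cons.
have h1 := gap_gt (v ++ u); have h2 := gap_le (v ++ u); have h3 := gap_lt (v ++ u).
case: d; split => //=.
- by apply: (sle_trans IH1); apply: (sle_trans (sltW h1)).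
- by apply: (sle_trans _ IH2); apply: (sle_trans h2); apply: sltW.
Qed.

Lemma quad_ge0 u : sle (0, 0) (quad u).1 /\ sle (quad u).2 (1, 1).
Proof. by have := quad_cat u [::]; rewrite cats0. Qed.

Lemma quadrilateral_sub q q' : sle q'.1 q.1 -> sle q.2 q'.2 ->
  quadrilateral q `<=` quadrilateral q'.
Proof.
move=> h1 h2 p [hy /andP[l r]]; split=> //; apply/andP; split.
- by apply: (le_trans _ l); apply: abscissa_le.
- by apply: (le_trans r); apply: abscissa_le.
Qed.

Lemma quadrilateral_cat v u : quadrilateral (quad (v ++ u)) `<=` quadrilateral (quad u).
Proof. by have [] := quad_cat v u; apply: quadrilateral_sub. Qed.

(** A V leaves halves of the bottom side and thirds of the top side, a Lambda the converse, so both
    widths are at least halved at each step. *)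
Lemma quad_width u : (quad u).2.1 - (quad u).1.1 <= 2^-1 ^+ size u /\
  (quad u).2.2 - (quad u).1.2 <= 2^-1 ^+ size u.
Proof.
elim: u => [|d u [IH1 IH2]]; first by rewrite expr0 /=; split; lra.
have [h1 h2] := quad_lt u.
rewrite quad_cons /= exprS /gap /draw.
move: IH1 IH2 h1 h2; case: (quad u) => [[a b] [a' b']] /=.
move: (_ ^+ _) => x.
by case: d; case: (~~ odd (size u)); rewrite /V_in /Lambda_in /=; split; lra.
Qed.

Lemma abscissa_width u y : 0 <= y <= 1 ->
  abscissa (quad u).2 y - abscissa (quad u).1 y <= 2^-1 ^+ size u.
Proof.
move=> /andP[y0 y1]; have [h1 h2] := quad_width u; rewrite /abscissa.
move: (_ ^+ _) h1 h2 => x; nra.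
Qed.

Lemma quad_separated u v : size u = size v -> u <> v ->
  sle (quad u).2 (quad v).1 \/ sle (quad v).2 (quad u).1.
Proof.
elim: u v => [|d u IH] [|d' v] //= [euv] ne.
have [e|neq] := pselect (u = v).
  subst v; have h := gap_le u.
  by move: ne; case: d; case: d' => // _; [right|left].
have [|h] := IH v euv neq.
  move=> h; left.
  have [_ h1] := quad_cat [:: d] u; have [h2 _] := quad_cat [:: d'] v.
  by apply: (sle_trans h1); apply: (sle_trans h).
right.
have [h1 _] := quad_cat [:: d] u; have [_ h2] := quad_cat [:: d'] v.
by apply: (sle_trans h2); apply: (sle_trans h).
Qed.

End Sides.

(** * The recursive drawing in terms of binary words *)

Section Drawing.
Context {R : realType}.
Implicit Types (s t : @side R) (q : @side R * @side R) (p : R * R).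
Implicit Types (u v w : seq bool).

Lemma word_cases u v : (size v <= size u)%N ->
  [\/ exists w, u = w ++ v, sle (@quad R u).2 (quad v).1 |
      sle (@quad R v).2 (quad u).1].
Proof.
move=> h; set k := (size u - size v)%N.
have e : u = take k u ++ drop k u by rewrite cat_take_drop.
have sz : size (drop k u) = size v by rewrite size_drop /k subKn.
have [d|nd] := pselect (drop k u = v).
  by apply: Or31; exists (take k u); rewrite -d cat_take_drop.
have [h1 h2] := @quad_cat R (take k u) (drop k u); rewrite -e in h1 h2.
have [h3|h3] := @quad_separated R _ _ sz nd.
  by apply: Or32; apply: (sle_trans h2).
by apply: Or33; apply: (sle_trans h3).
Qed.

Lemma cat_last w u : w <> [::] -> exists w' d, w ++ u = w' ++ d :: u.
Proof. by case/lastP: w => // w d _; exists w, d; rewrite cat_rcons. Qed.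

(** The closed form of [drawn n], established in [drawnE]. *)
Definition gaps (n : nat) : set (@zigzag R) :=
  [set gap u | u in [set u | (size u < n)%N]].

Lemma gaps_gap n u : (size u < n)%N -> gaps n (gap u).
Proof. by move=> h; exists u. Qed.

(** A leg of [gap v] lies in [quad v]. If [u] extends [v], the letter following [v] puts [quad u] on
    one side of that zigzag; otherwise the quadrilaterals of the two words are already separated. *)
Lemma allowed_side_quad n s u : allowed_side (gaps n) s -> size u = n ->
  sle s (quad u).1 \/ sle (quad u).2 s.
Proof.
move=> al su; have [q0 q1] := @quad_ge0 R u.
case: al => [->|->|[_ [v /= hv <-] hs]]; [by left|by right|].
have legs : sle (quad v).1 s /\ sle s (quad v).2.
  have h1 := sltW (@gap_gt R v); have h2 := @gap_le R v.
  have h3 := sltW (@gap_lt R v).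
  case: hs => ->; split => //.
  - by apply: (sle_trans h2).
  - by apply: (sle_trans h1).
have [||h|h] := @word_cases u v; first by rewrite su ltnW.
- case=> w e; have [wn|wn] := pselect (w = [::]).
    by move: hv; rewrite -su e wn /= ltnn.
  have [w' [d e']] := cat_last v wn.
  rewrite e e'; have [h1 h2] := @quad_cat R w' (d :: v).
  rewrite quad_cons in h1 h2.
  have h := @gap_le R v; case: d h1 h2 {e'} => /= h1 h2.
  + by left; case: hs => ->; first apply: (sle_trans h).
  + by right; case: hs => -> //; apply: (sle_trans _ h).
- by right; apply: (sle_trans h); case: legs.
- by left; apply: (sle_trans _ h); case: legs.
Qed.

Lemma allowed_side_gap n s v : allowed_side (gaps n) s ->
  sle s (gap v).1 \/ sle (gap v).2 s.
Proof.
move=> al; have h1 := sltW (@gap_gt R v); have h3 := sltW (@gap_lt R v).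
have inq t : sle t (quad v).1 \/ sle (quad v).2 t ->
    sle t (gap v).1 \/ sle (gap v).2 t.
  by case=> h; [left; apply: (sle_trans h)|right; apply: (sle_trans h3)].
case: al => [->|->|[_ [u /= hu <-] hs]].
- by apply: (inq); left; case: (@quad_ge0 R v).
- by apply: (inq); right; case: (@quad_ge0 R v).
have [lt|ge] := ltnP (size u) (size v).
  apply: inq; apply: (@allowed_side_quad (size v)) => //.
  by apply: Or33; exists (gap u) => //; exists u.
have g1 := sltW (@gap_gt R u); have g2 := sltW (@gap_lt R u).
have g := @gap_le R u.
have legs : sle (quad u).1 s /\ sle s (quad u).2.
  by case: hs => ->; split => //; [apply: (sle_trans g)|apply: (sle_trans g1)].
have [[w e]|h|h] := word_cases ge.
- have [wn|wn] := pselect (w = [::]).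
    by rewrite e wn /= in hs *; case: hs => ->; [left|right]; apply: sle_refl.
  have [w' [d e']] := cat_last v wn.
  have [k1 k2] := @quad_cat R w' (d :: v); rewrite -e' -e quad_cons in k1 k2.
  case: d k1 k2 {e'} => /= k1 k2.
  + by right; apply: (sle_trans k1); case: legs.
  + by left; apply: (sle_trans _ k2); case: legs.
- by apply: inq; left; apply: (sle_trans _ h); case: legs.
- by apply: inq; right; apply: (sle_trans h); case: legs.
Qed.

(** Always choosing the same direction keeps the side on that end. Every side is thus a side of
    arbitrarily thin quadrilaterals, which is how it gets approximated later on. *)
Lemma quad_nseq (b : bool) n u :
  pick_side b (@quad R (nseq n b ++ u)) = pick_side b (quad u).
Proof.
elim: n => [//|n IH] /=; rewrite -[child _ _ _]/(quad (b :: (nseq n b ++ u))).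
by rewrite -IH quad_cons; case: b {IH}.
Qed.

Lemma pick_side_allowed (d : bool) u :
  allowed_side (gaps (size u)) (pick_side d (@quad R u)).
Proof.
have mono n m s : (n <= m)%N -> allowed_side (gaps n) s -> allowed_side (gaps m) s.
  move=> nm [->|->|[F [v hv <-] hs]]; [exact: Or31|exact: Or32|apply: Or33].
  by exists (gap v) => //; exists v => //=; apply: leq_trans nm.
elim: u => [|b u IH]; first by case: d; [apply: Or32|apply: Or31].
rewrite quad_cons; have h := mono _ _ _ (leqnSn (size u)) IH.
have hg : gaps (size (b :: u)) (gap u) by apply: gaps_gap => /=.
case: b d h {IH} hg => -[] //= h hg.
- by apply: Or33; exists (gap u) => //; right.
- by apply: Or33; exists (gap u) => //; left.
Qed.

Lemma interior_quadrilateral q (x y : R) : 0 < y < 1 ->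
  abscissa q.1 y < x < abscissa q.2 y -> (quadrilateral q)° (x, y).
Proof.
move=> /andP[y0 y1] /andP[x0 x1].
have c2 : snd p @[p --> (x, y)] --> y by exact: cvg_snd.
have c1 : fst p @[p --> (x, y)] --> x by exact: cvg_fst.
have ca s : abscissa s p.2 @[p --> (x, y)] --> abscissa s y.
  apply: cvgD; apply: cvgM; try exact: cvg_cst; last exact: c2.
  by apply: cvgB; [exact: cvg_cst|exact: c2].
rewrite /interior /=; near=> p; split.
  apply/andP; split; apply: ltW; near: p.
    exact: (cvgr_gt y).
  exact: (cvgr_lt y).
apply/andP; split; apply: ltW; rewrite -subr_gt0; near: p.
- apply: (@cvgr_gt _ _ _ _ _ (x - abscissa q.1 y)); last by rewrite subr_gt0.
  by apply: cvgB.
- apply: (@cvgr_gt _ _ _ _ _ (abscissa q.2 y - x)); last by rewrite subr_gt0.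
  by apply: cvgB.
Unshelve. all: by end_near. Qed.

Lemma interior_quadrilateral_lt q p : (quadrilateral q)° p ->
  abscissa q.1 p.2 < p.1 < abscissa q.2 p.2.
Proof.
rewrite /interior /= => /nbhs_ballP[e /= e0 h].
have sub d : `|d| < e -> quadrilateral q (p.1 + d, p.2).
  move=> hd; apply: h; split => /=; last exact: ballxx.
  by rewrite /ball /= opprD addrA subrr sub0r normrN.
have e2 : `|e / 2| < e by rewrite ger0_norm; lra.
have [_ /= /andP[_ h1]] := sub _ e2.
have [|_ /= /andP[h2 _]] := sub (- (e / 2)); first by rewrite normrN.
by apply/andP; split; lra.
Qed.

(** The legs of a zigzag meet only at height 0 or 1; comparing at height 1/2 therefore keeps all
    inequalities strict. *)
Lemma sle_mid s t : sle s t -> abscissa t 2^-1 <= abscissa s 2^-1 -> s = t.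
Proof.
case: s t => [a b] [c d]; rewrite /sle /abscissa /= => -[h1 h2] h.
by congr (_, _); lra.
Qed.

Lemma half_in : 0 <= (2^-1 : R) <= 1. Proof. by apply/andP; split; lra. Qed.

Lemma apex_half n : (2^-1 : R) != apex n.
Proof. by apply/eqP; case: (@apexP R n) => ->; lra. Qed.

Lemma gap_shared u : abscissa (@gap R u).1 (apex (size u)) = abscissa (gap u).2 (apex (size u)).
Proof. by apply/eqP; rewrite gap_abscissa_eq. Qed.

(** For the inclusion from left to right, the left side determines the word, and the empty interior
    forces the right side to be the next one available. *)
Lemma Delta_gaps n : Delta (gaps n) = [set @quad R u | u in [set u | size u = n]].
Proof.
apply/seteqP; split; last first.
  move=> _ [u /= su <-]; have [lt1 lt2] := @quad_lt R u.
  have [q0 q1] := @quad_ge0 R u.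
  split => //.
  - move=> p /(@quadrilateral_sub _ (quad u) ((0, 0), (1, 1)) q0 q1) [/= hy].
    rewrite /abscissa /= => /andP[l r].
    by split=> //; apply/andP; split; lra.
  - by rewrite -su; split; [apply: (pick_side_allowed false)|apply: (pick_side_allowed true)].
  - case=> _ [v /= _ <-] [h1 h2].
    have a1 := @apex_ge0 R (size v).
    have := abscissa_lt a1 (@quad_lt R u); have e := gap_shared v.
    by case: h1 => ->; case: h2 => ->; rewrite ?e ltxx.
  - rewrite -subset0 => p [/interior_quadrilateral_lt /andP[l r] [_ [v /= hv <-] hp]].
    have hs s : is_leg (gap v) s -> segment s p -> False.
      move=> sl [hy e].
      have [||h|h] := @allowed_side_quad n s u.
      + by apply: Or33; exists (gap v) => //; exists v.
      + by [].
      + by have := abscissa_le hy h; rewrite -e; lra.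
      + by have := abscissa_le hy h; rewrite -e; lra.
    by case: hp; apply: hs; [left|right].
move=> q [[h1 h2] sq [al ar] nF hint].
set a := q.1 in h1 h2 al nF *; set b := q.2 in h1 h2 ar nF *.
(* A leg strictly between [a] and [b] at height 1/2 would pass through the interior of the
   quadrilateral. *)
have avoid s F : gaps n F -> is_leg F s ->
    abscissa a 2^-1 < abscissa s 2^-1 -> abscissa b 2^-1 <= abscissa s 2^-1.
  move=> DF sF ha; rewrite leNgt; apply/negP => hb.
  suff h : (set0 : set (R * R)) (abscissa s 2^-1, 2^-1) by exact: h.
  rewrite -hint; split.
    by apply: interior_quadrilateral; apply/andP; split => //; lra.
  by exists F => //; case: sF => ->; [left|right]; split => //=; exact: half_in.
have [b1 b2] : b.1 <= 1 /\ b.2 <= 1.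
  have [] := sq (b.1, 0); first (split => /=).
  - by rewrite lexx ler01.
  - by rewrite !abscissa0 lexx ltW.
    move=> /andP[_ B1] _.
  have [] := sq (b.2, 1); first (split => /=).
  - by rewrite lexx ler01.
  - by rewrite !abscissa1 lexx ltW.
    move=> /andP[_ B2] _.
  by [].
have mab : abscissa a 2^-1 < abscissa b 2^-1 by apply: abscissa_lt; [exact: half_in|split].
have main u : size u = n -> a = (quad u).1 -> [set @quad R u | u in [set u | size u = n]] q.
  move=> su ea; exists u => //.
  have [hb|hb] := allowed_side_quad ar su.
    by have [+ _] := hb; rewrite -ea => h; move: (le_lt_trans h h1); rewrite ltxx.
  suff e : (quad u).2 = b by rewrite [LHS]surjective_pairing -ea e -surjective_pairing.
  apply: (sle_mid hb).
  have lt : abscissa a 2^-1 < abscissa (quad u).2 2^-1.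
    by rewrite ea; apply: abscissa_lt; [exact: half_in|exact: quad_lt].
  case: (pick_side_allowed true u) => /= [e|e|[F DF hs]].
  - by have [[] _] := (@quad_lt R u, @quad_ge0 R u); rewrite e /=;
      case: (@quad_ge0 R u) => -[] /=; lra.
  - by rewrite e /abscissa /=; lra.
  - by apply: (avoid _ F) => //; rewrite -su.
case: (al) => [e|e|[_ [v /= hv <-] hs]].
- apply: (main (nseq n false)); first by rewrite size_nseq.
  by have := quad_nseq false n [::]; rewrite cats0 /= => ->.
- by move: h1; rewrite e /=; lra.
(* If [a] is the right leg of [gap v], the word turns right after [v] and then always left. If [a]
   is the left leg, [b] has to be the right leg of the same zigzag, which [Delta] excludes. *)
case: hs => e; last first.
  apply: (main (nseq (n - (size v).+1) false ++ true :: v)).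
    by rewrite size_cat size_nseq /= subnK.
  by have := quad_nseq false (n - (size v).+1) (true :: v) => /= ->.
exfalso; have [hb|hb] := allowed_side_gap v ar.
  by have [+ _] := hb; rewrite -e => h; move: (le_lt_trans h h1); rewrite ltxx.
have lt : abscissa a 2^-1 < abscissa (gap v).2 2^-1.
  by rewrite e; apply: gap_abscissa_lt; [exact: half_in|exact: apex_half].
have e2 : (gap v).2 = b.
  by apply: (sle_mid hb); apply: (avoid _ (gap v)) => //; [exists v|right].
by apply: nF; exists (gap v); [exists v|split; [left|right]].
Qed.

Lemma drawnE n : drawn n = gaps n.
Proof.
elim: n => [|n IH]; first by apply/seteqP; split => // F [].
rewrite /=; case: eqP => [->|n0].
  have e : (2^-1, 3^-1, (2^-1, 2 / 3)) = @gap R [::].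
    by rewrite /gap /draw /V_in /= subr0 mulr1 !add0r !mul1r.
  rewrite e; apply/seteqP; split => [_ ->|_ [[|//] _ <-] //].
  by exists [::].
rewrite IH Delta_gaps; apply/seteqP; split.
  move=> F [[u /= hu <-]|[_ [u /= su <-] <-]].
    by exists u => //=; apply: leqW.
  by exists u; rewrite /= ?su // /gap /draw su.
move=> _ [u /= hu <-]; rewrite ltnS leq_eqVlt in hu.
case/orP: hu => [/eqP e|h]; last by left; exists u.
by right; exists (quad u); [exists u|rewrite /gap /draw e].
Qed.

End Drawing.

(** * The accordion as a nested intersection *)

Section AccordionPoints.
Context {R : realType}.
Implicit Types (s t : @side R) (q : @side R * @side R) (p : R * R).
Implicit Types (u v w : seq bool).

Lemma continuous_closed_le (T : topologicalType) (f g : T -> R) :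
  continuous f -> continuous g -> closed [set z | f z <= g z].
Proof.
move=> cf cg.
have -> : [set z | f z <= g z] = (fun z => g z - f z) @^-1` [set x | 0 <= x].
  by apply/seteqP; split => z /=; rewrite subr_ge0.
have cgf : continuous (fun z => g z - f z).
  by move=> z; apply: cvgB; [exact: cg|exact: cf].
by move/continuous_closedP: cgf; apply; exact: closed_ge.
Qed.

Lemma continuous_open_lt (T : topologicalType) (f g : T -> R) :
  continuous f -> continuous g -> open [set z | f z < g z].
Proof.
move=> cf cg; have -> : [set z | f z < g z] = ~` [set z | g z <= f z].
  by apply/seteqP; split => z /=; rewrite ltNge => /negP.
by rewrite openC; apply: continuous_closed_le.
Qed.

Lemma continuous_abscissa s : continuous (abscissa s).
Proof.
move=> y; apply: cvgD; apply: cvgM; try exact: cvg_cst; last exact: cvg_id.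
by apply: cvgB; [exact: cvg_cst|exact: cvg_id].
Qed.

Lemma continuous_abscissa2 s : continuous (fun p => abscissa s p.2).
Proof.
move=> p; apply: (@continuous_comp _ _ _ snd (abscissa s)); first exact: cvg_snd.
exact: continuous_abscissa.
Qed.

Lemma closed_height : closed [set p : R * R | 0 <= p.2 <= 1].
Proof.
have -> : [set p : R * R | 0 <= p.2 <= 1] =
    [set p : R * R | 0 <= p.2] `&` [set p : R * R | p.2 <= 1].
  by apply/seteqP; split => p /=; [move/andP|move=> []/[swap] -> ->].
by apply: closedI; apply: continuous_closed_le => p; try exact: cvg_cst; exact: cvg_snd.
Qed.

Lemma closed_quadrilateral q : closed (quadrilateral q).
Proof.
have -> : quadrilateral q = [set p : R * R | 0 <= p.2 <= 1] `&`
    ([set p | abscissa q.1 p.2 <= p.1] `&` [set p | p.1 <= abscissa q.2 p.2]).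
  by apply/seteqP; split => p /= [h1]; [move/andP|case=> h2 h3]; split => //; apply/andP.
apply: closedI; first exact: closed_height.
by apply: closedI; apply: continuous_closed_le => p;
  try exact: continuous_abscissa2; exact: cvg_fst.
Qed.

Lemma finite_words n : finite_set [set u : seq bool | size u = n].
Proof.
have -> : [set u : seq bool | size u = n] = [set tval t | t in [set: n.-tuple bool]].
  apply/seteqP; split => [u /= /eqP su|_ [t _ <-] /=]; last by rewrite size_tuple.
  by exists (Tuple su).
exact/finite_image/finite_finset.
Qed.

Definition accordion : set (R * R) :=
  [set p | forall n, exists2 u, size u = n & quadrilateral (quad u) p].

Lemma accordion_height p : accordion p -> 0 <= p.2 <= 1.
Proof. by move=> /(_ 0%N)[u _ []]. Qed.

Lemma closed_accordion : closed accordion.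
Proof.
have -> : accordion =
    \bigcap_n \bigcup_(u in [set u : seq bool | size u = n]) quadrilateral (quad u).
  apply/seteqP; split => p h n; first by move=> _; have [u] := h n; exists u.
  by have [//|u] := h n; exists u.
apply: closed_bigI => n _; apply: closed_bigcup; first exact: finite_words.
by move=> u _; apply: closed_quadrilateral.
Qed.


Lemma segment_quad d u : segment (pick_side d (quad u)) `<=` quadrilateral (@quad R u).
Proof.
move=> p [hy e]; split => //; rewrite e; have := abscissa_le hy (sltW (@quad_lt R u)).
by case: d {e} => /= h; rewrite lexx h.
Qed.

Lemma segment_accordion d u : segment (pick_side d (@quad R u)) `<=` accordion.
Proof.
move=> p hp n; have [nu|un] := leqP n (size u); last first.
  exists (nseq (n - size u) d ++ u); first by rewrite size_cat size_nseq subnK // ltnW.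
  by apply: (@segment_quad d); rewrite quad_nseq.
exists (drop (size u - n) u); first by rewrite size_drop subKn.
apply: (@quadrilateral_cat _ (take (size u - n) u)); rewrite cat_take_drop.
exact: (@segment_quad d).
Qed.

Lemma expr_half_lt (e : R) : 0 < e -> exists n, 2^-1 ^+ n < e.
Proof.
move=> e0; have h : `|2^-1 : R| < 1 by rewrite ger0_norm; lra.
have := cvg_geometric 1 h; rewrite /geometric /=.
under eq_fun do rewrite mul1r.
move=> /cvgr_lt /(_ _ e0) [N _ hN]; exists N; exact: hN (leqnn N).
Qed.

Lemma accordion_near p (e : R) d : accordion p -> 0 < e ->
  exists2 u, quadrilateral (quad u) p & `|p.1 - abscissa (pick_side d (quad u)) p.2| < e.
Proof.
move=> hp e0; have [n hn] := expr_half_lt e0; have [u su hu] := hp n.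
exists u => //; case: (hu) => hy /andP[l r].
have := abscissa_width u hy; rewrite su.
move: (_ ^+ n) hn => x hx hw.
by case: d => /=; rewrite ltr_norml; apply/andP; split; lra.
Qed.

(** Every leg drawn is a side of some quadrilateral, and sides persist at all levels. Conversely a
    point of [quad u] is within the width of [quad u] of the left leg drawn there, at the same
    height. *)
Lemma knaster_accordionE : knaster_accordion R = accordion.
Proof.
apply/seteqP; split.
  rewrite [X in _ `<=` X](closure_id _).1; last exact: closed_accordion.
  apply: closure_subset => p [n _]; rewrite drawnE => -[_ [u _ <-] hp].
  case: hp => hp; first exact: (@segment_accordion true (false :: u)).
  exact: (@segment_accordion false (true :: u)).
move=> p hp; rewrite /knaster_accordion closureEnbhs => A B hA /nbhs_ballP[e /= e0 he].
have hy := accordion_height hp.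
have [n hn] := expr_half_lt e0; have [u su [_ /andP[l r]]] := hp n.
exists (abscissa (gap u).1 p.2, p.2); split.
  apply: hA; exists (size u).+1 => //; rewrite drawnE; exists (gap u).
    exact: gaps_gap.
  by left; split.
apply: he; split => /=; last exact: ballxx.
have := abscissa_width u hy; rewrite su /ball /=; move: (_ ^+ n) hn => x hx hw.
have h1 := abscissa_le hy (sltW (@gap_gt R u)); have h2 := abscissa_le hy (@gap_le R u).
have h3 := abscissa_le hy (sltW (@gap_lt R u)).
by rewrite ltr_norml; apply/andP; split; lra.
Qed.

Lemma compact_accordion : compact accordion.
Proof.
apply: (@subclosed_compact _ _ (`[0, 1]%classic `*` `[0, 1]%classic : set (R * R))).
- exact: closed_accordion.
- by apply: compact_setX; apply: segment_compact.
move=> p hp; have /andP[y0 y1] := accordion_height hp.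
have [[|//] _ [_ /andP[]]] := hp 0%N; rewrite /abscissa /= => h1 h2.
by split; rewrite /= in_itv /=; apply/andP; split => //; lra.
Qed.

Lemma accordion_gap u p : accordion p ->
  p.1 <= abscissa (gap u).1 p.2 \/ abscissa (gap u).2 p.2 <= p.1.
Proof.
move=> hp; have hy := accordion_height hp.
have [[//|d v] [sv] [_ /andP[l r]]] := hp (size u).+1.
rewrite quad_cons in l r.
have [e|ne] := pselect (v = u).
  by subst v; case: d l r => /= l r; [right|left].
have [hv1 hv2] := @quad_cat R [:: d] v.
rewrite /= -[child _ _ _]/(quad (d :: v)) quad_cons in hv1 hv2.
have h1 := abscissa_le hy (sltW (@gap_gt R u)).
have h3 := abscissa_le hy (sltW (@gap_lt R u)).
have k1 := abscissa_le hy hv1; have k2 := abscissa_le hy hv2.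
have [/(abscissa_le hy) h|/(abscissa_le hy) h] := @quad_separated R _ _ sv ne.
- by left; lra.
- by right; lra.
Qed.

End AccordionPoints.

(** * Separation by vertices *)

Section Separation.
Context {R : realType}.
Implicit Types (s : @side R) (p q w x z : R * R) (u v : seq bool) (A B X : set (R * R)).

(** Removal of the cut point [w] separates [x] from [z]. Closed pieces sharing only [w] are used,
    since these are easily carried along injective continuous maps of compact sets. *)
Definition separates X w x z := [/\ x <> w, z <> w &
  exists A B, [/\ closed A, closed B, A `|` B = X, A `&` B = [set w] & A x /\ B z]].

Lemma separatesC X w x z : separates X w x z -> separates X w z x.
Proof.
case=> xw zw [A [B [cA cB AB iAB [Ax Bz]]]]; split=> //; exists B, A.
by rewrite setUC setIC.
Qed.

Lemma connected_closed_cover (T : topologicalType) (C A B : set T) (x y : T) :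
  connected C -> closed A -> closed B -> C `<=` A `|` B ->
  (forall t, C t -> A t -> B t -> False) -> C x -> A x -> C y -> A y.
Proof.
move=> cC cA cB CAB dis Cx Ax Cy.
suff e : C `&` A = C by rewrite -e in Cy; case: Cy.
apply: cC; first by exists x.
- exists (~` B); first by rewrite openC.
  apply/seteqP; split => t [Ct ht]; split => //; first by move/(dis t Ct ht).
  by case: (CAB t Ct).
- by exists A.
Qed.

Lemma continuous_pair (T U V : topologicalType) (f : T -> U) (g : T -> V) :
  continuous f -> continuous g -> continuous (fun t => (f t, g t)).
Proof.
move=> cf cg t.
exact: (@cvg_pair _ _ _ (nbhs t) (nbhs (f t)) (nbhs (g t)) _ _ _ f g (cf t) (cg t)).
Qed.

Lemma connected_side s (a b : R) : connected [set (abscissa s y, y) | y in `[a, b]].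
Proof.
apply: connected_continuous_connected; first exact: segment_connected.
apply: continuous_subspaceT; apply: continuous_pair; first exact: continuous_abscissa.
by move=> y; exact: cvg_id.
Qed.

Lemma segmentE s : segment s = [set (abscissa s y, y) | y in `[0, 1]].
Proof.
apply/seteqP; split => [[x y] [/= hy ->]|_ [y hy <-]].
  by exists y; rewrite //= in_itv.
by split => //=; move: hy; rewrite /= in_itv.
Qed.

Lemma closed_horizontal A (x y : R) : closed A ->
  (forall e, 0 < e -> exists2 x', `|x - x'| < e & A (x', y)) -> A (x, y).
Proof.
move=> cA h; apply: cA; rewrite closureEnbhs => C D hC /nbhs_ballP[e /= e0 he].
have [x' hx Ax'] := h _ e0; exists (x', y); split; first exact: hC.
by apply: he; split => //=; exact: ballxx.
Qed.

Definition splitting A B w :=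
  [/\ closed A, closed B, A `|` B = @accordion R & A `&` B = [set w]].

Lemma splittingC A B w : splitting A B w -> splitting B A w.
Proof. by case=> *; split; rewrite // 1?setUC 1?setIC. Qed.

Lemma splitting_mem A B w p : splitting A B w -> accordion p -> A p \/ B p.
Proof. by case=> _ _ e _; rewrite -e. Qed.

Lemma splitting_eq A B w p : splitting A B w -> A p -> B p -> p = w.
Proof. by case=> _ _ _ e Ap Bp; have : (A `&` B) p by []; rewrite e. Qed.

Lemma segment_color_avoid A B w s p q : splitting A B w ->
  segment s `<=` accordion -> ~ segment s w -> segment s p -> segment s q ->
  A p -> A q.
Proof.
move=> sp sK ws hp hq Ap; case: (sp) => cA cB AB iAB.
apply: (@connected_closed_cover _ (segment s) A B p) => //.
- by rewrite segmentE; exact: connected_side.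
- by rewrite AB.
- by move=> t st At Bt; apply: ws; rewrite -(splitting_eq sp At Bt).
Qed.

(* A side through the cut point is approximated by sides which avoid it. *)
Lemma side_color A B w d u p q : splitting A B w ->
  segment (pick_side d (quad u)) p -> segment (pick_side d (quad u)) q ->
  p <> w -> q <> w -> A p -> A q.
Proof.
move=> sp hp hq pw qw Ap; set s := pick_side d (@quad R u).
have [ws|ws] := pselect (segment s w); last first.
  exact: (segment_color_avoid sp (@segment_accordion _ d u) ws hp hq Ap).
apply: contrapT => nAq; case: (sp) => cA cB AB iAB.
have near (C : set (R * R)) (t : R * R) : closed C -> ~ C t -> segment s t ->
    exists2 e : R, 0 < e & forall x' : R, `|t.1 - x'| < e -> ~ C (x', t.2).
  move=> cC nCt st; apply: contrapT => hn; apply: nCt.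
  rewrite [t]surjective_pairing; apply: closed_horizontal => // e e0.
  apply: contrapT => h; apply: hn; exists e => // x' hx' Cx'; apply: h.
  by exists x'.
have nBp : ~ B p by move=> Bp; apply: pw; apply: (splitting_eq sp).
have [e1 e10 h1] := near _ _ cB nBp hp; have [e2 e20 h2] := near _ _ cA nAq hq.
have [n hn] : exists n, 2^-1 ^+ n < Order.min e1 e2.
  by apply: expr_half_lt; rewrite lt_min e10 e20.
(* [s] is still a side of this thin quadrilateral and [c] is the opposite one. They never meet, so
   [c] misses [w] and has one colour, while it passes too close to [p] and to [q] for their colours
   to differ. *)
set q' := @quad R (nseq n d ++ u); set c := pick_side (~~ d) q'.
have es : pick_side d q' = s by rewrite /q' quad_nseq.
have close y : 0 <= y <= 1 ->
    abscissa s y != abscissa c y /\ `|abscissa s y - abscissa c y| < Order.min e1 e2.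
  move=> hy; have lt := abscissa_lt hy (@quad_lt R (nseq n d ++ u)).
  have le := abscissa_width (nseq n d ++ u) hy.
  rewrite size_cat size_nseq exprD in le.
  have le' : (2^-1 : R) ^+ n * 2^-1 ^+ size u <= 2^-1 ^+ n.
    by rewrite ler_piMr ?exprn_ge0 ?exprn_ile1 //; lra.
  have hw := le_lt_trans (le_trans le le') hn.
  move: lt hw; rewrite -/q' -es /c; move: (Order.min e1 e2) => m lt hw.
  case: (d) => /=; split.
  - by rewrite gt_eqF.
  - by rewrite ger0_norm //; lra.
  - by rewrite lt_eqF.
  - by rewrite ler0_norm; lra.
have cK : segment c `<=` accordion by exact: segment_accordion.
have cw : ~ segment c w.
  move=> [hy e]; case: ws => _ e'; have [+ _] := close _ hy.
  by rewrite -e -e' eqxx.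
have yp := hp.1; have yq := hq.1.
have memc y : 0 <= y <= 1 -> segment c (abscissa c y, y) by split.
have Ac : A (abscissa c p.2, p.2).
  case: (splitting_mem sp (cK _ (memc _ yp))) => // Bc; exfalso.
  apply: (h1 (abscissa c p.2)) => //; case: (hp) => _ ->.
  by have [_ /lt_le_trans] := close _ yp; apply; rewrite ge_min lexx.
have := segment_color_avoid sp cK cw (memc _ yp) (memc _ yq) Ac.
apply: h2; case: (hq) => _ ->.
by have [_ /lt_le_trans] := close _ yq; apply; rewrite ge_min lexx orbT.
Qed.

Definition vertex u : R * R := (abscissa (gap u).1 (apex (size u)), apex (size u)).

Lemma segment_vertex u : segment (gap u).1 (vertex u) /\ segment (gap u).2 (vertex u).
Proof. by split; split; rewrite /= ?apex_ge0 // -gap_shared. Qed.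

Lemma gap_color A B w u p q : splitting A B w -> vertex u <> w ->
  segment (gap u).1 p -> segment (gap u).2 q -> p <> w -> q <> w -> A p <-> A q.
Proof.
move=> sp vw hp hq pw qw; have [h1 h2] := segment_vertex u; split=> h.
- apply: (@side_color _ _ _ false (true :: u) (vertex u) _ sp) => //.
  exact: (@side_color _ _ _ true (false :: u) p _ sp).
- apply: (@side_color _ _ _ true (false :: u) (vertex u) _ sp) => //.
  exact: (@side_color _ _ _ false (true :: u) q _ sp).
Qed.

(** Suppose the left side is in [A] and the right side in [B]. By [gap_color] a vertex other than
    [w] transmits colours, so one of the two children is in the same situation. The nested
    quadrilaterals shrink to a point in both [A] and [B]. *)
Lemma bisection A B w u p q : splitting A B w ->
  (forall v, vertex (v ++ u) <> w) ->
  segment (quad u).1 p -> segment (quad u).2 q -> p <> w -> q <> w -> A p -> A q.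
Proof.
move=> sp nv hp hq pw qw Ap; apply: contrapT => nAq.
case: (sp) => cA cB AB iAB.
have Bq : B q.
  by case: (splitting_mem sp (@segment_accordion _ true u _ hq)).
(* All is done at a height different from that of [w], so that the limit point cannot be [w]. *)
have [y0 hy yw] : exists2 y, 0 <= y <= 1 & y <> w.2.
  have [e|ne] := pselect (w.2 = 0); first by exists 1; rewrite ?ler01 ?lexx // e; lra.
  by exists 0; rewrite ?ler01 ?lexx // => h; apply: ne.
pose pt d v : R * R := (abscissa (pick_side d (quad v)) y0, y0).
have ptw d v : pt d v <> w by move=> e; apply: yw; rewrite -e.
have ptseg d v : segment (pick_side d (quad v)) (pt d v) by split.
pose P v := A (pt false v) /\ B (pt true v).
have P0 : P u.
  split; first exact: (@side_color _ _ _ false u p _ sp).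
  exact: (@side_color _ _ _ true u q _ (splittingC sp)).
have step v : P (v ++ u) -> P (false :: v ++ u) \/ P (true :: v ++ u).
  case=> [A1 B1].
  have [A2|B2] := splitting_mem sp (@segment_accordion _ true (false :: (v ++ u)) _ (ptseg _ _)).
    right; split => //.
    exact: (gap_color sp (nv v) (ptseg true (false :: (v ++ u)))
      (ptseg false (true :: (v ++ u))) (ptw _ _) (ptw _ _)).1.
  by left.
pose f := fix f n := if n is m.+1 then (~~ `[< P (false :: f m) >]) :: f m else u.
have fP n : (exists v, f n = v ++ u) /\ P (f n).
  elim: n => [|n [[v e] IH]]; first by split => //; exists [::].
  split; first by rewrite /= {2}e; eexists (_ :: v).
  rewrite /=; case: asboolP => //= h; rewrite e in IH h *.
  by have [] := step v IH.
have fs n : size (f n) = (n + size u)%N by elim: n => //= n ->.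
pose l n := abscissa (quad (f n)).1 y0; pose r n := abscissa (quad (f n)).2 y0.
have mono m n : (m <= n)%N -> l m <= l n /\ r n <= r m.
  move=> /subnK <-; elim: (n - m)%N => [//|k [IH1 IH2]].
  have [h1 h2] := @quad_cat R [:: ~~ `[< P (false :: f (k + m)%N) >]] (f (k + m)%N).
  by have := abscissa_le hy h1; have := abscissa_le hy h2; rewrite /l /r; split;
    [apply: (le_trans IH1)|apply: (le_trans _ IH2)].
have lr n : l n <= r n by apply: abscissa_le => //; exact/sltW/quad_lt.
have lr2 m n : l m <= r n.
  have [h1 _] := mono _ _ (leq_maxl m n); have [_ h2] := mono _ _ (leq_maxr m n).
  by apply: (le_trans h1); apply: (le_trans (lr _)).
have hs : has_sup (range l).
  by split; [exists (l 0%N), 0%N|exists (r 0%N) => _ [n _ <-]].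
pose L := sup (range l).
have Ll n : l n <= L by apply: ub_le_sup; [exact: hs.2|exists n].
have Lr n : L <= r n by apply: ge_sup; [exact: hs.1|move=> _ [m _ <-]].
have rl e : 0 < e -> exists n, r n - l n < e.
  move=> e0; have [n hn] := expr_half_lt e0; exists n.
  apply: (le_lt_trans (abscissa_width _ hy)); apply: le_lt_trans hn.
  by rewrite fs exprD ler_piMr ?exprn_ge0 ?exprn_ile1 //; lra.
have AL : A (L, y0).
  apply: closed_horizontal => // e /rl[n hn]; exists (l n); last by case: (fP n) => _ [].
  by have := Ll n; have := Lr n; move=> *; rewrite ger0_norm; lra.
have BL : B (L, y0).
  apply: closed_horizontal => // e /rl[n hn]; exists (r n); last by case: (fP n) => _ [].
  by have := Ll n; have := Lr n; move=> *; rewrite ler0_norm; lra.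
by apply: yw; rewrite -(splitting_eq sp AL BL).
Qed.

(** If [w] is no vertex, [bisection] and [gap_color] give all sides of all quadrilaterals the same
    colour, and every point is a horizontal limit of points on sides. *)
Lemma no_splitting A B w : splitting A B w -> (forall u, vertex u <> w) ->
  (forall q, accordion q -> q <> w -> A q) \/ (forall q, accordion q -> q <> w -> B q).
Proof.
move=> sp nv.
have [y0 hy yw] : exists2 y, 0 <= y <= 1 & y <> w.2.
  have [e|ne] := pselect (w.2 = 0); first by exists 1; rewrite ?ler01 ?lexx // e; lra.
  by exists 0; rewrite ?ler01 ?lexx // => h; apply: ne.
pose pt d v : R * R := (abscissa (pick_side d (quad v)) y0, y0).
have ptw d v : pt d v <> w by move=> e; apply: yw; rewrite -e.
have ptseg d v : segment (pick_side d (quad v)) (pt d v) by split.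
have main C D : splitting C D w -> C (pt false [::]) ->
    forall q, accordion q -> q <> w -> C q.
  move=> {}sp h0.
  have all u : C (pt false u) /\ C (pt true u).
    elim: u => [|d u [IH1 IH2]].
      split => //; apply: (bisection (u := [::]) sp _ (ptseg false [::]) (ptseg true [::])) => //.
    have C1 : C (pt true (false :: u)).
      by apply: (bisection (u := false :: u) sp _ (ptseg false (false :: u))
        (ptseg true (false :: u))).
    case: d; split => //.
    exact: (gap_color sp (nv u) (ptseg true (false :: u)) (ptseg false (true :: u))
      (ptw _ _) (ptw _ _)).1.
  move=> q hq qw; rewrite [q]surjective_pairing; apply: closed_horizontal; first by case: sp.
  move=> e e0.
  have [e' e'0 [he' hw]] : exists2 e' : R, 0 < e' & e' <= e /\
      forall x : R, `|q.1 - x| < e' -> (x, q.2) <> w.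
    have [e2|ne] := pselect (q.2 = w.2); last first.
      by exists e => //; split => // x _ h; apply: ne; rewrite -h.
    have d0 : 0 < `|q.1 - w.1|.
      rewrite normr_gt0 subr_eq0; apply/eqP => e1; apply: qw.
      by rewrite [q]surjective_pairing e1 e2 -surjective_pairing.
    exists (Order.min e `|q.1 - w.1|); first by rewrite lt_min e0 d0.
    split; first by rewrite ge_min lexx.
    by move=> x; rewrite lt_min => /andP[_ h] h'; move: h; rewrite -h' ltxx.
  have [u hu hx] := accordion_near false hq e'0.
  exists (abscissa (pick_side false (quad u)) q.2); first exact: lt_le_trans he'.
  apply: (@side_color _ _ _ false u (pt false u) _ sp) => //; last exact: (all u).1.
  - by split => //=; case: hu.
  - exact: hw.
case: (splitting_mem sp (@segment_accordion _ false [::] _ (ptseg _ _))) => h.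
- by left; apply: (main A B).
- by right; apply: (main B A) => //; exact: splittingC.
Qed.

Lemma separates_vertex w x z : separates accordion w x z -> exists u, vertex u = w.
Proof.
case=> xw zw [A [B [cA cB AB iAB [Ax Bz]]]].
apply: contrapT => nv; have sp : splitting A B w by [].
have Kx : accordion x by rewrite -AB; left.
have Kz : accordion z by rewrite -AB; right.
have [|h|h] := no_splitting sp; first by move=> u e; apply: nv; exists u.
- by apply: (zw); apply: (splitting_eq sp) => //; exact: h.
- by apply: (xw); apply: (splitting_eq sp) => //; exact: h.
Qed.

Lemma gap_separates u x z : accordion x -> accordion z ->
  x.1 <= abscissa (gap u).1 x.2 -> abscissa (gap u).2 z.2 <= z.1 ->
  x <> vertex u -> z <> vertex u -> separates accordion (vertex u) x z.
Proof.
move=> Kx Kz hx hz xv zv; split => //.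
exists (accordion `&` [set p | p.1 <= abscissa (gap u).1 p.2]),
       (accordion `&` [set p | abscissa (gap u).2 p.2 <= p.1]); split => //.
- apply: closedI; first exact: closed_accordion.
  by apply: continuous_closed_le => p; [exact: cvg_fst|exact: continuous_abscissa2].
- apply: closedI; first exact: closed_accordion.
  by apply: continuous_closed_le => p; [exact: continuous_abscissa2|exact: cvg_fst].
- rewrite -setIUr; apply/seteqP; split => p; first by case.
  by move=> hp; split => //; apply: accordion_gap.
apply/seteqP; split => p.
  case=> -[Kp /= h1] [_ /= h2]; have hy := accordion_height Kp.
  have h3 := abscissa_le hy (@gap_le R u).
  have e : p.2 = apex (size u) by apply/eqP; rewrite -gap_abscissa_eq; apply/eqP; lra.
  rewrite [p]surjective_pairing /vertex -e; congr (_, _); lra.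
move=> ->; have [h1 h2] := segment_vertex u.
split; split => /=; rewrite -?gap_shared //; exact: (@segment_accordion _ true (false :: u)).
Qed.

(** The vertex of a longer word is strictly between the sides of its quadrilateral at that height,
    and this quadrilateral lies on one side of the older zigzag or of its quadrilateral. *)
Lemma vertex_inj : injective vertex.
Proof.
suff wl u v : (size v <= size u)%N -> vertex u = vertex v -> u = v.
  move=> u v e; have [h|/ltnW h] := leqP (size v) (size u); first exact: wl.
  by apply: esym; apply: wl.
move=> h [e ey]; rewrite ey in e.
have hy := @apex_ge0 R (size v).
have g1 := abscissa_lt hy (@gap_gt R u); have g2 := abscissa_le hy (@gap_le R u).
have g3 := abscissa_lt hy (@gap_lt R u); have gs := @gap_shared R u; rewrite ey in gs.
have k1 := abscissa_lt hy (@gap_gt R v); have k3 := abscissa_lt hy (@gap_lt R v).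
have ks := @gap_shared R v.
have [[w ew]|k|k] := word_cases (R := R) h.
- have [wn|wn] := pselect (w = [::]); first by rewrite ew wn.
  have [w' [d ew']] := cat_last v wn.
  have [] := @quad_cat R w' (d :: v); rewrite -ew' -ew quad_cons.
  by case: d {ew'} => /= /(abscissa_le hy) m1 /(abscissa_le hy) m2; exfalso; lra.
- by exfalso; have := abscissa_le hy k; lra.
- by exfalso; have := abscissa_le hy k; lra.
Qed.

End Separation.

(** * Blocks and embeddings *)

Section Blocks.
Context {R : realType}.
Implicit Types (p q : R * R) (u v : seq bool) (j k : nat) (sigma : nat -> bool).

Definition spine j := nseq j true.

(** The bottom width of [quad (spine j)]: a V (even index) leaves its right half, a Lambda (odd
    index) its right third. *)
Fixpoint scale j : R := if j is k.+1 then scale k / (if odd k then 3 else 2) else 1.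

Lemma scale_gt0 j : 0 < scale j.
Proof. by elim: j => //= j IH; case: (odd j); rewrite divr_gt0. Qed.

Lemma quad_spine j : quad (spine j) =
  ((1 - scale j, if odd j then 1 - 2 / 3 * scale j else 1 - scale j), (1, 1)).
Proof.
elim: j => [|j IH]; first by rewrite /= !subrr.
rewrite /spine -[nseq _ _]/(true :: spine j) quad_cons /gap IH size_nseq /draw /=.
by case: (odd j) => /=; rewrite /V_in /Lambda_in /=; congr (_, _, _); field.
Qed.

Lemma gap_spine1 j : (gap (spine j)).1 =
  if odd j then (1 - 2 / 3 * scale j, 1 - scale j / 3)
  else (1 - scale j / 2, 1 - 2 / 3 * scale j).
Proof.
rewrite /gap quad_spine size_nseq /draw /=.
by case: (odd j) => /=; rewrite /V_in /Lambda_in /=; congr (_, _); field.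
Qed.

(* Measured from its entry vertex, a block is traversed from height 0 to 1. *)
Definition hgt j (y : R) : R := if odd j then y else 1 - y.

Lemma hgtK j : involutive (hgt j).
Proof. by move=> y; rewrite /hgt; case: odd => //; rewrite subKr. Qed.

Lemma hgtS j y : hgt j.+1 y = 1 - hgt j y.
Proof. by rewrite /hgt /=; case: (odd j) => //=; rewrite subKr. Qed.

Lemma hgt_in j y : (0 <= hgt j y <= 1) = (0 <= y <= 1).
Proof. by rewrite /hgt; case: odd => //; rewrite subr_ge0 lerBlDr lerDl andbC. Qed.

Lemma continuous_hgt j : continuous (hgt j).
Proof.
move=> y; rewrite /hgt; case: odd; first exact: cvg_id.
by apply: cvgB; [exact: cvg_cst|exact: cvg_id].
Qed.

(** For positive [j] this is the vertex shared by blocks [j.-1] and [j]; [entry 0] is only the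
    corner (0,1), which lets block 0 be treated like the others. *)
Definition entry j : R * R := (1 - scale j, hgt j 0).

Definition step j : R := scale j - scale j.+1.
(* Widths of block [j] at the heights of its entry and of its exit. *)
Definition width0 j : R := scale j / 3.
Definition width1 j : R := if odd j then scale j / 3 else scale j / 2.

Lemma scale_le j : scale j <= 2^-1 ^+ j.
Proof.
elim: j => [|j IH]; first by rewrite expr0.
have h := scale_gt0 j; rewrite exprS /=; move: (_ ^+ j) IH => x IH.
by case: (odd j); lra.
Qed.

Lemma block_sizes j : [/\ [/\ 0 < scale j, scale j <= 1 & 0 < scale j.+1],
  [/\ 0 < step j & step j <= scale j], [/\ 0 < width0 j, width0 j <= step j & width0 j <= 3^-1] &
  [/\ 0 < width1 j, width1 j <= step j & width1 j <= 2^-1]].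
Proof.
have h := scale_gt0 j; have h1 : scale j <= 1.
  by apply: (le_trans (scale_le j)); rewrite exprn_ile1 //; lra.
by rewrite /step /width0 /width1 /=; case: (odd j); split; split => //; lra.
Qed.

Lemma vertex_spine j : vertex (spine j) = entry j.+1.
Proof.
rewrite /vertex gap_spine1 size_nseq /apex /entry /hgt /= /abscissa.
by case: (odd j) => /=; congr (_, _); field.
Qed.

(* Signed horizontal distance to the diagonal from the entry to the exit of block [j]. *)
Definition offset j p : R := p.1 - (1 - scale j + step j * hgt j p.2).

Definition inblock j : set (R * R) := quadrilateral (quad (false :: spine j)).

Lemma left_offset j p : p.1 - abscissa (quad (spine j)).1 p.2 =
  offset j p + width1 j * hgt j p.2.
Proof.
rewrite quad_spine /offset /abscissa /step /width1 /hgt /=.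
by case: (odd j) => /=; field.
Qed.

Lemma right_offset j p : abscissa (gap (spine j)).1 p.2 - p.1 =
  width0 j * (1 - hgt j p.2) - offset j p.
Proof.
rewrite gap_spine1 /offset /abscissa /step /width0 /hgt /=.
by case: (odd j) => /=; field.
Qed.

(** In the coordinates [hgt] and [offset] the left side is a line through the entry and the right
    side a line through the exit. *)
Lemma inblockP j p : inblock j p <-> 0 <= hgt j p.2 <= 1 /\
  - (width1 j * hgt j p.2) <= offset j p <= width0 j * (1 - hgt j p.2).
Proof.
rewrite hgt_in; have l := left_offset j p; have r := right_offset j p.
rewrite /inblock /quadrilateral quad_cons /=.
by split=> -[hy /andP[h1 h2]]; split => //; apply/andP; split; lra.
Qed.

Lemma spineS_le j k : (j <= k)%N -> sle (@quad R (spine j)).1 (quad (spine k)).1.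
Proof.
move=> /subnK <-; rewrite /spine nseqD; exact: (quad_cat _ _).1.
Qed.

Lemma inblock_spine j p : inblock j p -> quadrilateral (quad (spine j)) p.
Proof. exact: (@quadrilateral_cat _ [:: false]). Qed.

Lemma vertexP u p : 0 <= p.2 <= 1 -> p.1 <= abscissa (gap u).1 p.2 ->
  abscissa (gap u).2 p.2 <= p.1 -> p = @vertex R u.
Proof.
move=> hy h1 h2; have h3 := abscissa_le hy (@gap_le R u).
have e : p.2 = apex (size u) by apply/eqP; rewrite -gap_abscissa_eq; apply/eqP; lra.
by rewrite [p]surjective_pairing /vertex -e; congr (_, _); lra.
Qed.

Lemma inblock_meet j k p : (j < k)%N -> inblock j p -> inblock k p ->
  k = j.+1 /\ p = entry j.+1.
Proof.
move=> jk [hy /andP[_ h1]] /inblock_spine [_ /andP[h2 _]].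
have h3 := abscissa_le hy (spineS_le jk).
rewrite -[spine j.+1]/(true :: spine j) quad_cons /= in h3.
rewrite quad_cons /= in h1.
have h4 := abscissa_le hy (@gap_le R (spine j)).
split; last by rewrite -vertex_spine; apply: vertexP => //; lra.
apply/eqP; rewrite eqn_leq jk andbT leqNgt; apply/negP => jk2.
have k1 := abscissa_le hy (spineS_le jk2).
rewrite -[spine j.+2]/(true :: spine j.+1) quad_cons /= in k1.
have k2 := abscissa_lt hy (@gap_gt R (spine j.+1)).
have k3 := abscissa_le hy (@gap_le R (spine j.+1)).
rewrite -[spine j.+1]/(true :: spine j) quad_cons /= in k2 k3.
rewrite -[true :: spine j]/(spine j.+1) in k2 k3 k1.
lra.
Qed.

Lemma word_spine u : u = spine (size u) \/ exists v j, u = v ++ false :: spine j.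
Proof.
elim: u => [|d u [IH|[v [j IH]]]]; first by left.
- case: d; first by left; rewrite {1}IH.
  by right; exists [::], (size u); rewrite /= {1}IH.
- by right; exists (d :: v), j; rewrite IH.
Qed.

Lemma accordion_cases p : accordion p ->
  (p.1 = 1 /\ 0 <= p.2 <= 1) \/ exists j, inblock j p.
Proof.
move=> hp; have hy := accordion_height hp.
have [|no] := pselect (exists j, inblock j p); [by right|left; split => //].
have sp n : quadrilateral (quad (spine n)) p.
  have [u su hu] := hp n; have [e|[v [j e]]] := word_spine u.
    by rewrite -su -e.
  by case: no; exists j; apply: (@quadrilateral_cat _ v); rewrite -e.
apply/eqP; rewrite eq_le; apply/andP; split.
  have [_ /andP[_]] := sp 0%N; rewrite /abscissa /=; lra.
apply/ler_addgt0Pr => e e0; have [n hn] := expr_half_lt e0.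
have [_ /andP[h _]] := sp n; have := scale_le n; have := scale_gt0 n.
move: h; rewrite quad_spine /abscissa /=; move: (_ ^+ n) hn => x hn.
case/andP: hy => y0 y1; case: (odd n) => h s0 s1; last lra.
have : (1 - p.2) * (scale n) + p.2 * (2 / 3 * scale n) <= scale n by nra.
lra.
Qed.

Definition sgb (b : bool) : R := if b then 1 else -1.

(* The affine map which fixes the entry and the exit of block [j]; it reverses
   the orientation of the plane or not, according to [sigma j]. *)
Definition block_map sigma j p : R * R :=
  (1 - scale j + step j * hgt j p.2 + step j / 2 * offset j p,
   hgt j (hgt j p.2 + sgb (sigma j) * offset j p)).

(** Which block is picked does not matter: two blocks meet at most in a shared vertex, fixed by both
    maps. The default 0 of [xget] is caught by the test. *)
Definition unfold sigma p : R * R :=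
  let j := xget 0%N [set j | inblock j p] in
  if `[< inblock j p >] then block_map sigma j p else p.

Lemma entry_coord j : hgt j (entry j).2 = 0 /\ offset j (entry j) = 0.
Proof. by rewrite /offset /= hgtK mulr0 addr0 subrr. Qed.

Lemma exit_coord j : hgt j (entry j.+1).2 = 1 /\ offset j (entry j.+1) = 0.
Proof.
have e : hgt j (entry j.+1).2 = 1 by rewrite /= hgtS /hgt; case: (odd j); lra.
by rewrite /offset e /entry /step /=; split => //; lra.
Qed.

Lemma coord_entry j p : hgt j p.2 = 0 -> offset j p = 0 -> p = entry j.
Proof.
case: p => x y /=; rewrite /offset /= => hy; rewrite hy mulr0 addr0 => hx.
rewrite /entry; congr (_, _); first lra.
by rewrite -hy hgtK.
Qed.

Lemma coord_exit j p : hgt j p.2 = 1 -> offset j p = 0 -> p = entry j.+1.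
Proof.
case: p => x y /=; rewrite /offset /= => hy; rewrite hy mulr1 => hx.
rewrite /entry; congr (_, _); first by move: hx; rewrite /step; lra.
by rewrite -(hgtK j y) hy hgtS /hgt; case: (odd j); lra.
Qed.

Lemma block_map_entry sigma j : block_map sigma j (entry j) = entry j.
Proof.
rewrite /block_map; have [-> ->] := entry_coord j.
by rewrite !mulr0 !addr0.
Qed.

Lemma block_map_exit sigma j : block_map sigma j (entry j.+1) = entry j.+1.
Proof.
rewrite /block_map; have [-> ->] := exit_coord j.
by rewrite !mulr0 !addr0 mulr1 /entry /step; congr (_, _); [lra|rewrite hgtS /hgt; case: odd; lra].
Qed.

Lemma unfoldE sigma j p : inblock j p -> unfold sigma p = block_map sigma j p.
Proof.
move=> hj; rewrite /unfold.
have hk : inblock (xget 0%N [set j | inblock j p]) p.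
  by apply: (@xgetPex _ 0%N [set j | inblock j p]); exists j.
rewrite asboolT //; move: (xget _ _) hk => k hk.
have [jk|kj|->//] := ltngtP j k.
- have [-> ->] := inblock_meet jk hj hk; by rewrite block_map_entry block_map_exit.
- have [-> ->] := inblock_meet kj hk hj; by rewrite block_map_entry block_map_exit.
Qed.

Lemma inblock_lt1 j p : inblock j p -> p.1 <= 1 - scale j.+1.
Proof.
move=> /inblockP[/andP[y0 y1] /andP[_ h2]]; have [[_ _ s3] [s4 _] [s5 s6 _] _] := block_sizes j.
have : step j * hgt j p.2 + width0 j * (1 - hgt j p.2) <= step j by nra.
have es : scale j.+1 = scale j - step j by rewrite /step; lra.
by move: h2; rewrite /offset; lra.
Qed.

Lemma unfold_side1 sigma p : p.1 = 1 -> unfold sigma p = p.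
Proof.
rewrite /unfold => e; case: asboolP => // /inblock_lt1; rewrite e => h; exfalso.
by have := scale_gt0 (xget 0%N [set j | inblock j p]).+1; lra.
Qed.

Lemma unfold_entry sigma j : unfold sigma (entry j) = entry j.
Proof.
rewrite (@unfoldE _ j) ?block_map_entry //; apply/inblockP.
have [-> ->] := entry_coord j; have [_ _ [s5 _ _] _] := block_sizes j.
by split; apply/andP; split; rewrite ?mulr0 ?subr0 ?mulr1 ?oppr0; lra.
Qed.

(** Halving the offset in the abscissa is what puts the image of each block in a vertical strip of
    its own, touching the borders only at the entry and the exit. The constants 3/4 and 5/6 come
    from [width1 j <= 2^-1] and [width0 j <= 3^-1]. *)
Lemma block_map_x sigma j p : inblock j p ->
  [/\ 1 - scale j <= (block_map sigma j p).1 <= 1 - scale j.+1,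
      (block_map sigma j p).1 = 1 - scale j -> p = entry j &
      (block_map sigma j p).1 = 1 - scale j.+1 -> p = entry j.+1].
Proof.
move=> /inblockP[/andP[y0 y1] /andP[h1 h2]].
have [[s1 s2 s3] [s4 s4'] [s5 s6 s7] [s8 s9 s10]] := block_sizes j.
have -> : (block_map sigma j p).1 = 1 - scale j + step j * (hgt j p.2 + offset j p / 2).
  by rewrite /block_map /=; field.
have es : scale j.+1 = scale j - step j by rewrite /step; lra.
have g1 : hgt j p.2 * (3 / 4) <= hgt j p.2 + offset j p / 2 by nra.
have g2 : hgt j p.2 + offset j p / 2 <= 1 - (1 - hgt j p.2) * (5 / 6) by nra.
split.
- apply/andP; split; nra.
- move=> e; have e0 : hgt j p.2 + offset j p / 2 = 0.
    have /eqP : step j * (hgt j p.2 + offset j p / 2) = 0 by lra.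
    by rewrite mulf_eq0 gt_eqF //= => /eqP.
  by have e1 : hgt j p.2 = 0 by [lra]; apply: coord_entry => //; lra.
- move=> e; have e0 : hgt j p.2 + offset j p / 2 - 1 = 0.
    have /eqP : step j * (hgt j p.2 + offset j p / 2 - 1) = 0 by lra.
    by rewrite mulf_eq0 gt_eqF //= => /eqP.
  by have e1 : hgt j p.2 = 1 by [lra]; apply: coord_exit => //; lra.
Qed.

Lemma sgb_cases b : sgb b = 1 \/ sgb b = -1.
Proof. by case: b; [left|right]. Qed.

(** In the coordinates [hgt] and [offset] the linear part has determinant
    [step j * (sgb (sigma j) - 2^-1)]: it is nonzero and its sign is that of [sgb (sigma j)]. *)
Lemma block_map_inj sigma j : injective (block_map sigma j).
Proof.
move=> p q; rewrite /block_map => -[e1 /(can_inj (hgtK j)) e2].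
have s4 : 0 < step j by have [_ [] ] := block_sizes j.
have e3 : hgt j p.2 + offset j p / 2 = hgt j q.2 + offset j q / 2.
  by apply: (mulfI (lt0r_neq0 s4)); lra.
have e4 : offset j p = offset j q.
  by case: (sgb_cases (sigma j)) e2 => ->; lra.
have e5 : hgt j p.2 = hgt j q.2 by lra.
move: e4; rewrite /offset e5 => e6.
rewrite [p]surjective_pairing [q]surjective_pairing; congr (_, _); first lra.
exact: (can_inj (hgtK j)).
Qed.

(** Whole blocks, holes included: injectivity on this larger set shows that the image of a point in
    a hole misses the image of the accordion. *)
Definition hull : set (R * R) :=
  [set p | (p.1 = 1 /\ 0 <= p.2 <= 1) \/ exists j, inblock j p].

Lemma scale_lt j k : (j < k)%N -> scale k <= scale j.+1.
Proof.
elim: k => // k IH; rewrite ltnS leq_eqVlt => /orP[/eqP -> //|/IH].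
by apply: le_trans; have [_ [+ _] _ _] := block_sizes k; rewrite /step; lra.
Qed.

Lemma unfold_inj sigma p q : hull p -> hull q -> unfold sigma p = unfold sigma q -> p = q.
Proof.
have lt j r : inblock j r -> (unfold sigma r).1 < 1.
  move=> hr; rewrite (unfoldE _ hr); have [/andP[_ h] _ _] := block_map_x sigma hr.
  by have := scale_gt0 j.+1; lra.
have wl j k r s : (j < k)%N -> inblock j r -> inblock k s ->
    unfold sigma r = unfold sigma s -> r = s.
  move=> jk hr hs; rewrite (unfoldE _ hr) (unfoldE _ hs) => e.
  have [/andP[_ h1] _ h2] := block_map_x sigma hr.
  have [/andP[k1 _] k2 _] := block_map_x sigma hs.
  have := scale_lt jk; rewrite e in h1 h2 => sc.
  have er : r = entry j.+1 by apply: h2; lra.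
  have es : s = entry k by apply: k2; lra.
  rewrite -e in k1; move: e; rewrite er es block_map_entry block_map_exit.
  by move=> ->.
case=> [[p1 _]|[j hj]] [[q1 _]|[k hk]].
- by rewrite !unfold_side1.
- by rewrite (unfold_side1 _ p1) => e; have := lt _ _ hk; rewrite -e p1 ltxx.
- by rewrite (unfold_side1 _ q1) => e; have := lt _ _ hj; rewrite e q1 ltxx.
have [jk|kj|e] := ltngtP j k; first exact: (wl j k).
  by move=> e; apply/esym/(wl k j).
by subst k; rewrite (unfoldE _ hj) (unfoldE _ hk); apply: block_map_inj.
Qed.

Lemma accordion_hull : accordion `<=` hull.
Proof. by move=> p /accordion_cases. Qed.

End Blocks.

(** * Continuity of the unfolding, and injective continuous images of compact sets *)

Section Embedding.
Context {R : realType}.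
Implicit Types (p q x z : R * R) (j k : nat) (sigma : nat -> bool).

Lemma block_map_near sigma j p : inblock j p ->
  `|(block_map sigma j p).1 - p.1| <= scale j /\ `|(block_map sigma j p).2 - p.2| <= scale j.
Proof.
move=> hj; have [/andP[k1 k2] _ _] := block_map_x sigma hj.
have k3 := inblock_lt1 hj; have [[s1 s2 s3] [s4 s4'] [s5 s6 s7] [s8 s9 s10]] := @block_sizes R j.
have [hy /andP[k4 _]] := inblock_spine hj.
have k5 : 1 - scale j <= p.1.
  apply: (le_trans _ k4); rewrite quad_spine /abscissa /=; case/andP: hy => y0 y1.
  by case: (odd j); nra.
have [/andP[y0 y1] /andP[h1 h2]] := (inblockP j p).1 hj.
split; first by rewrite ler_norml; apply/andP; split; lra.
have hD : `|offset j p| <= scale j by rewrite ler_norml; apply/andP; split; nra.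
rewrite [X in X - _]/=; set D := offset j p in hD *.
have -> : `|hgt j (hgt j p.2 + sgb (sigma j) * D) - p.2| = `|sgb (sigma j) * D|.
  rewrite /hgt; case: (odd j); first by congr `|_|; lra.
  by rewrite -normrN; congr `|_|; lra.
by case: (@sgb_cases R (sigma j)) => ->; rewrite ?mul1r ?mulN1r ?normrN.
Qed.

Lemma continuous_offset j : continuous (@offset R j).
Proof.
move=> p; apply: cvgB; first exact: cvg_fst.
apply: cvgD; first exact: cvg_cst.
apply: cvgM; first exact: cvg_cst.
by apply: (@continuous_comp _ _ _ snd (hgt j)); [exact: cvg_snd|exact: continuous_hgt].
Qed.

Lemma continuous_block_map sigma j : continuous (@block_map R sigma j).
Proof.
have ch : continuous (fun p : R * R => hgt j p.2).
  by move=> p; apply: (@continuous_comp _ _ _ snd (hgt j)); [exact: cvg_snd|exact: continuous_hgt].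
apply: continuous_pair => p.
  apply: cvgD; last by apply: cvgM; [exact: cvg_cst|exact: continuous_offset].
  by apply: cvgD; [exact: cvg_cst|apply: cvgM; [exact: cvg_cst|exact: ch]].
apply: (@continuous_comp _ _ _ (fun p => hgt j p.2 + sgb (sigma j) * offset j p) (hgt j)).
  by apply: cvgD; [exact: ch|apply: cvgM; [exact: cvg_cst|exact: continuous_offset]].
exact: continuous_hgt.
Qed.

Lemma inblock_ge j n p : (n <= j)%N -> inblock j p -> 1 - scale n <= p.1.
Proof.
move=> nj hj; have [hy /andP[k4 _]] := inblock_spine hj.
have := abscissa_le hy (spineS_le (R := R) nj).
have s := @scale_gt0 R n.
have : 1 - scale n <= abscissa (quad (spine n)).1 p.2.
  rewrite quad_spine /abscissa /=; case/andP: hy => y0 y1.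
  by case: (odd n); nra.
lra.
Qed.

(** At the limit side, nearby blocks have large index and move points by at most [scale k].
    Elsewhere only finitely many blocks come near, each closed and mapped continuously. *)
Lemma unfold_near sigma p N : accordion p -> nbhs (unfold sigma p) N ->
  \forall q \near p, accordion q -> N (unfold sigma q).
Proof.
move=> hp hN.
case: (accordion_cases hp) => [[p1 _]|[j hj]].
  rewrite (unfold_side1 sigma p1) in hN; have [e /= e0 he] := (nbhs_ballP _ _).1 hN.
  have [n hn] : exists n, @scale R n < e / 2.
    have [n hn] := expr_half_lt (divr_gt0 e0 (ltr0Sn R 1)).
    by exists n; apply: le_lt_trans hn; exact: scale_le.
  have cball : \forall q \near p, ball p (e / 2) q.
    by apply: nbhsx_ballx; rewrite divr_gt0.
  have cx : \forall q \near p, 1 - scale n < q.1.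
    have c1 : fst q @[q --> p] --> p.1 by exact: cvg_fst.
    by apply: (@cvgr_gt _ _ _ _ _ p.1 c1); rewrite p1; have := @scale_gt0 R n; lra.
  near=> q => hq.
  have [b1 b2] : ball p (e / 2) q by near: q.
  have qn : 1 - scale n < q.1 by near: q.
  case: (accordion_cases hq) => [[q1 _]|[k hk]].
    rewrite unfold_side1 //; apply: he; split => /=;
      apply: (le_ball _ b1) || apply: (le_ball _ b2); lra.
  rewrite (unfoldE _ hk); apply: he.
  have nk : (n <= k)%N.
    rewrite leqNgt; apply/negP => kn.
    by have := inblock_lt1 hk; have := @scale_lt R _ _ kn; lra.
  have sk : @scale R k <= scale n.
    case: (ltngtP n k) nk => // [nk _|-> //]; apply: (le_trans (scale_lt nk)).
    by have [_ [+ _] _ _] := @block_sizes R n; rewrite /step; lra.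
  have [m1 m2] := block_map_near sigma hk.
  rewrite /ball /= in b1 b2.
  split; rewrite /ball /=.
    rewrite -[p.1](subrK q.1) -addrA; apply: (le_lt_trans (ler_normD _ _)).
    by rewrite (distrC q.1); lra.
  rewrite -[p.2](subrK q.2) -addrA; apply: (le_lt_trans (ler_normD _ _)).
  by rewrite (distrC q.2); lra.
have [n hn] : exists n, p.1 < 1 - @scale R n.
  exists j.+2; have := inblock_lt1 hj.
  by have [_ [+ _] _ _] := @block_sizes R j.+1; rewrite {1}/step; lra.
have cx : \forall q \near p, q.1 < 1 - scale n.
  have c1 : fst q @[q --> p] --> p.1 by exact: cvg_fst.
  by apply: (@cvgr_lt _ _ _ _ _ p.1 c1).
have ck k : \forall q \near p, inblock k q -> N (unfold sigma q).
  have [hk|nk] := pselect (inblock k p).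
    rewrite (unfoldE _ hk) in hN.
    have hN' : \forall q \near p, N (block_map sigma k q).
      exact: (@continuous_block_map sigma k p _ hN).
    by near=> q => hkq; rewrite (unfoldE _ hkq); near: q.
  have hn' : \forall q \near p, (~` inblock k) q.
    by apply: open_nbhs_nbhs; split => //; rewrite openC; exact: closed_quadrilateral.
  near=> q => hkq; exfalso; suff : (~` inblock k) q by apply.
  by near: q.
have call := @filter_forall _ 'I_n (fun (i : 'I_n) q => inblock i q -> N (unfold sigma q))
  (nbhs p) _ (fun i => ck i).
near=> q => hq.
have qn : q.1 < 1 - scale n by near: q.
have qk : forall k : 'I_n, inblock k q -> N (unfold sigma q) by near: q; exact: call.
case: (accordion_cases hq) => [[q1 _]|[k hk]].
  by exfalso; have := @scale_gt0 R n; lra.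
have kn : (k < n)%N.
  by rewrite ltnNge; apply/negP => nk; have := inblock_ge nk hk; lra.
exact: (qk (Ordinal kn)).
Unshelve. all: by end_near. Qed.

Lemma continuous_unfold sigma : {within @accordion R, continuous (unfold sigma)}.
Proof. by apply/subspace_continuousP => p hp N hN; exact: unfold_near. Qed.

Section CompactImage.
Context (X : set (R * R)) (f : R * R -> R * R).
Context (cX : compact X) (cf : {within X, continuous f})
  (injf : forall p q, X p -> X q -> f p = f q -> p = q).

Lemma closed_image A : closed A -> closed (f @` (X `&` A)).
Proof.
move=> cA; apply: compact_closed; first exact: norm_hausdorff.
apply: continuous_compact; last exact: compact_closedI.
by apply: continuous_subspaceW cf => p [].
Qed.

Lemma closed_preimage A : closed A -> closed (X `&` f @^-1` A).
Proof.
move=> cA; have clX : closed X by apply: compact_closed => //; exact: norm_hausdorff.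
have /continuous_closedP/(_ _ cA)/closed_subspaceP[V cV e] := cf.
by rewrite setIC -e; exact: closedI.
Qed.

Lemma separates_image w x z : X w ->
  separates X w x z -> separates (f @` X) (f w) (f x) (f z).
Proof.
move=> Xw [xw zw [A [B [cA cB AB iAB [Ax Bz]]]]].
have Xx : X x by rewrite -AB; left.
have Xz : X z by rewrite -AB; right.
split; [by move/(injf Xx Xw)|by move/(injf Xz Xw)|].
exists (f @` (X `&` A)), (f @` (X `&` B)); split; [exact: closed_image|exact: closed_image|..].
- by rewrite -image_setU -setIUr AB setIid.
- apply/seteqP; split => y.
    case=> -[a [Xa Aa] <-] [b [Xb Bb]] /(injf Xb Xa) e; subst b.
    have : (A `&` B) a by [].
    by rewrite iAB => ->.
  move=> ->; have : (A `&` B) w by rewrite iAB.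
  by case=> Aw Bw; split; exists w.
- by split; [exists x|exists z].
Qed.

Lemma separates_preimage w x z : X w -> X x -> X z ->
  separates (f @` X) (f w) (f x) (f z) -> separates X w x z.
Proof.
move=> Xw Xx Xz [xw zw [A [B [cA cB AB iAB [Ax Bz]]]]].
split; [by move=> e; apply: xw; rewrite e|by move=> e; apply: zw; rewrite e|].
exists (X `&` f @^-1` A), (X `&` f @^-1` B); split;
  [exact: closed_preimage|exact: closed_preimage|..].
- rewrite -setIUr; apply/seteqP; split => p; first by case.
  by move=> Xp; split => //; have : (f @` X) (f p) by [exists p]; rewrite -AB.
- apply/seteqP; split => p.
    case=> -[Xp /= Ap] [_ /= Bp]; have : (A `&` B) (f p) by [].
    by rewrite iAB => /(injf Xp Xw).
  move=> ->; have : (A `&` B) (f w) by rewrite iAB.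
  by case.
- by [].
Qed.

Lemma planar_embedding_compact : planar_embedding (fun t : set_type X => f (val t)).
Proof.
set phi := fun t : set_type X => f (val t).
have Xv (t : set_type X) : X (val t) by apply: set_mem; exact: valP.
have inv (y : set_type (range phi)) : exists t, phi t = val y.
  by have /set_mem[t _ e] := valP y; exists t.
pose g y := projT1 (cid (inv y)).
have gP y : phi (g y) = val y by rewrite /g; case: cid.
have phi_inj : injective phi.
  by move=> s t e; apply: val_inj; apply: injf.
have c1 : cancel (onto_range phi) g by move=> t; apply: phi_inj; rewrite gP.
exists g; split => //.
- by move=> y; apply: val_inj; exact: gP.
- apply: continuous_comp_initial.
  exact: ((subspace_sigL_continuousP X f).1 cf).
apply/continuousP => A [W oW eA].
have : open (~` (f @` (X `&` ~` W))).
  by rewrite openC; apply: closed_image; rewrite closedC.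
move=> oV; exists (~` (f @` (X `&` ~` W))) => //.
apply/seteqP; split => y /=.
  move=> h; rewrite -eA /=; apply: contrapT => nO; apply: h.
  by exists (val (g y)); [split|exact: gP].
rewrite -eA /= => Oy [p [Xp nO] e]; apply: nO.
suff -> : p = val (g y) by [].
by apply: injf => //; apply: (etrans e); apply: esym; exact: gP.
Qed.

End CompactImage.

End Embedding.

(** * Facing cut points *)

Section Invariants.
Context {R : realType}.
Implicit Types (p q v x z : R * R) (X N A B : set (R * R)).

Definition joined X N v x :=
  exists A, [/\ connected A, A `<=` X `&` N, A v & A x].

(** Legs are not mentioned, so that homeomorphisms of the plane preserve the notion. At a shared
    vertex, [joined] in a small [N] confines the ends of the path to the legs at [v] ([joined_leg]),
    and [separates] puts them on different legs ([same_leg_not_separates]). *)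
Definition facing X v := forall N, nbhs v N -> exists g : R -> R * R,
  [/\ continuous g, forall t, 0 <= t <= 1 -> N (g t),
      forall t, 0 < t < 1 -> ~ X (g t),
      joined X N v (g 0) /\ joined X N v (g 1) & separates X v (g 0) (g 1)].

Definition special X v := (exists x z, separates X v x z) /\ ~ facing X v.

Section Homeomorphism.
Context (h g : R * R -> R * R).
Context (hK : cancel h g) (gK : cancel g h) (ch : continuous h) (cg : continuous g).

Lemma image_homeo A : h @` A = g @^-1` A.
Proof.
apply/seteqP; split => y /=; first by case=> x Ax <-; rewrite hK.
by move=> Ay; exists (g y).
Qed.

Lemma separates_homeo X v x z : separates X v x z -> separates (h @` X) (h v) (h x) (h z).
Proof.
have hinj := can_inj hK.
case=> xv zv [A [B [cA cB AB iAB [Ax Bz]]]].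
split; [by move/hinj|by move/hinj|exists (h @` A), (h @` B)]; split.
- by rewrite image_homeo; move/continuous_closedP: cg; apply.
- by rewrite image_homeo; move/continuous_closedP: cg; apply.
- by rewrite -image_setU AB.
- rewrite !image_homeo -preimage_setI iAB; apply/seteqP; split => y /=.
    by move=> <-; rewrite gK.
  by move=> ->; rewrite hK.
- by split; [exists x|exists z].
Qed.

Lemma facing_homeo X v : facing X v -> facing (h @` X) (h v).
Proof.
move=> fX N hN; have [c [cc cN cX [j0 j1] sep]] := fX _ (ch hN).
have jh x : joined X (h @^-1` N) v x -> joined (h @` X) N (h v) (h x).
  case=> A [cA AX Av Ax]; exists (h @` A); split.
  - by apply: connected_continuous_connected cA _; apply: continuous_subspaceT.
  - by move=> _ [y /AX[Xy Ny] <-]; split => //; exists y.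
  - by exists v.
  - by exists x.
exists (h \o c); split.
- by move=> t; apply: continuous_comp; [exact: cc|exact: ch].
- by move=> t /cN.
- by move=> t /cX nX [y Xy /(can_inj hK) e]; apply: nX; rewrite -e.
- by split; exact: jh.
- exact: separates_homeo.
Qed.

End Homeomorphism.

Lemma special_homeo (h g : R * R -> R * R) X v : cancel h g -> cancel g h ->
  continuous h -> continuous g -> special X v -> special (h @` X) (h v).
Proof.
move=> hK gK ch cg [[x [z sep]] nf]; split.
  by exists (h x), (h z); exact: (separates_homeo hK gK cg).
move=> /(facing_homeo gK hK cg ch); rewrite hK.
rewrite (image_homeo gK hK) /= => f; apply: nf.
suff -> : X = h @^-1` (h @` X) by [].
apply/seteqP; split => y /=; first by move=> Xy; exists y.
by case=> y' Xy' /(can_inj hK) <-.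
Qed.

Definition unfolded sigma : set (R * R) := unfold sigma @` accordion.

Lemma unfold_accordion_inj sigma p q : accordion p -> accordion q ->
  unfold sigma p = unfold sigma q -> p = q.
Proof. by move=> hp hq; apply: unfold_inj; exact: accordion_hull. Qed.

Lemma image_separates sigma w x z : accordion w ->
  separates accordion w x z ->
  separates (unfolded sigma) (unfold sigma w) (unfold sigma x) (unfold sigma z).
Proof.
exact: (separates_image compact_accordion (@continuous_unfold R sigma)
  (@unfold_accordion_inj sigma)).
Qed.

Lemma abscissa_lipschitz d u (y y' : R) :
  `|abscissa (pick_side d (quad u)) y - abscissa (pick_side d (quad u)) y'| <= `|y - y'|.
Proof.
set s := pick_side d _.
have [[h1 h2] [h3 h4]] : sle (0, 0) s /\ sle s (1, 1).
  have [h1 h2] := @quad_ge0 R u; have h3 := sltW (@quad_lt R u).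
  by rewrite /s; case: d {s}; split => //; [apply: (sle_trans h1)|apply: (sle_trans h3)].
have -> : abscissa s y - abscissa s y' = (s.2 - s.1) * (y - y').
  by rewrite /abscissa; ring.
rewrite normrM ler_piMl // ler_norml /=; apply/andP; rewrite /= in h1 h2 h3 h4; split; lra.
Qed.

(** The whole hole bounded by the zigzag lies in block [j], on which [unfold] is one affine map. The
    image of a horizontal segment across the hole, near the vertex, is the required path. *)
Lemma gap_facing_block sigma j (v : seq bool) :
  let u := v ++ false :: spine j in facing (unfolded sigma) (unfold sigma (vertex u)).
Proof.
move=> u N hN; set F := @gap R u.
have inF p : 0 <= p.2 <= 1 -> abscissa F.1 p.2 <= p.1 <= abscissa F.2 p.2 -> inblock j p.
  move=> hy /andP[h1 h2]; apply: (@quadrilateral_cat _ v); split => //; apply/andP.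
  have := abscissa_le hy (sltW (@gap_gt R u)); have := abscissa_le hy (sltW (@gap_lt R u)).
  by split; [apply: (le_trans _ h1)|apply: (le_trans h2)].
set a : R := apex (size u); have ha : 0 <= a <= 1 := @apex_ge0 R _.
have sF : abscissa F.1 a = abscissa F.2 a := @gap_shared R u.
have inv : inblock j (@vertex R u).
  by apply: (inF (vertex u)); rewrite /vertex /= -/a -/F // -sF lexx.
rewrite (unfoldE _ inv) in hN *.
have [e /= e0 he] := (nbhs_ballP _ _).1 (@continuous_block_map R sigma j _ _ hN).
pose d := Order.min e 1 / 2.
have m0 : 0 < Order.min e 1 by rewrite lt_min e0 ltr01.
have d0 : 0 < d by rewrite /d; lra.
have [de d1] : d < e /\ d < 1.
  have : Order.min e 1 <= e by rewrite ge_min lexx.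
  have : Order.min e 1 <= 1 by rewrite ge_min lexx orbT.
  by rewrite /d; split; lra.
(* A window of heights of length [d] with the height [a] of the vertex at one end; the crossing is
   made at the other end [y]. *)
have [lo [hi [y [[lo0 hi1 hd] [alo ahi] [ylo yhi] ya]]]] : exists lo hi y,
    [/\ [/\ 0 <= lo, hi <= 1 & hi - lo <= d], lo <= a /\ a <= hi, lo <= y /\ y <= hi & y != a].
  case: (@apexP R (size u)) => ea; rewrite /a ea.
    by exists 0, d, d; split; [split|split|split|apply/eqP]; lra.
  by exists (1 - d), 1, (1 - d); split; [split|split|split|apply/eqP]; lra.
have hy : 0 <= y <= 1 by apply/andP; split; lra.
have legq b : exists d' u', pick_side b F = pick_side d' (@quad R u').
  by case: b; [exists false, (true :: u)|exists true, (false :: u)].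
have legK b t : 0 <= t <= 1 -> accordion (abscissa (pick_side b F) t, t).
  by have [d' [u' ->]] := legq b => ht; apply: (@segment_accordion _ d' u'); split.
have legB b t : 0 <= t <= 1 -> inblock j (abscissa (pick_side b F) t, t).
  move=> ht; apply: inF => //=; have := abscissa_le ht (@gap_le R u).
  by case: b => /= h; rewrite lexx h.
have close b t : lo <= t <= hi -> ball (@vertex R u) e (abscissa (pick_side b F) t, t).
  move=> /andP[t0 t1]; have ht : `|a - t| < e by rewrite ltr_norml; apply/andP; split; lra.
  split; rewrite /ball //= -/a.
  have -> : abscissa (gap u).1 a = abscissa (pick_side b F) a by case: b.
  by have [d' [u' ->]] := legq b; apply: le_lt_trans ht; exact: abscissa_lipschitz.
have yI : lo <= y <= hi by rewrite ylo yhi.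
have aI : lo <= a <= hi by rewrite alo ahi.
have lt : abscissa F.1 y < abscissa F.2 y by apply: gap_abscissa_lt.
pose c t : R * R := ((1 - t) * abscissa F.1 y + t * abscissa F.2 y, y).
have cbe t : 0 <= t <= 1 -> abscissa F.1 y <= (c t).1 <= abscissa F.2 y.
  by move=> /andP[t0 t1] /=; apply/andP; split; nra.
have cb t : 0 <= t <= 1 -> inblock j (c t) by move=> ht; apply: inF => //; exact: cbe.
have c0 : c 0 = (abscissa (pick_side false F) y, y) by rewrite /c /=; congr (_, _); lra.
have c1 : c 1 = (abscissa (pick_side true F) y, y) by rewrite /c /=; congr (_, _); lra.
have jn b : joined (unfolded sigma) N (block_map sigma j (vertex u))
    (block_map sigma j (abscissa (pick_side b F) y, y)).
  exists (block_map sigma j @` [set (abscissa (pick_side b F) t, t) | t in `[lo, hi]]).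
  split.
  - apply: connected_continuous_connected; first exact: connected_side.
    by apply: continuous_subspaceT; exact: continuous_block_map.
  - move=> _ [_ [t tI <-] <-]; move: tI; rewrite /= in_itv /= => /andP[t0 t1].
    have ht : 0 <= t <= 1 by apply/andP; split; lra.
    split; last by apply: he; apply: close; rewrite t0 t1.
    by exists (abscissa (pick_side b F) t, t); [exact: legK|rewrite (unfoldE _ (legB b t ht))].
  - exists (vertex u) => //; exists a; first by rewrite /= in_itv /= alo ahi.
    by rewrite /vertex -/a; case: b => /=; rewrite ?sF.
  - exists (abscissa (pick_side b F) y, y) => //; exists y => //; by rewrite /= in_itv /= ylo yhi.
have vN b : (abscissa (pick_side b F) y, y) <> @vertex R u.
  by move=> [_ e2]; rewrite e2 eqxx in ya.
have cc : continuous c.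
  apply: continuous_pair => t; last exact: cvg_cst.
  apply: cvgD; apply: cvgM; try exact: cvg_cst; last exact: cvg_id.
  by apply: cvgB; [exact: cvg_cst|exact: cvg_id].
exists (block_map sigma j \o c); split.
- by move=> t; apply: continuous_comp; [exact: cc|exact: continuous_block_map].
- move=> t ht; apply: he; have /andP[g1 g2] := cbe _ ht.
  have [b1 b2] := close false y yI; have [b3 _] := close true y yI.
  split => //; move: b1 b3; rewrite /ball /= !ltr_norml => /andP[f1 f2] /andP[f3 f4].
  by apply/andP; rewrite /= in g1 g2; split; lra.
(* [c t] is in the hole, hence outside the accordion but in [hull], where [unfold] is injective. *)
- move=> t /andP[t0 t1] [p Kp]; have ht : 0 <= t <= 1 by rewrite !ltW.
  rewrite /= -(unfoldE sigma (cb _ ht)) => e1.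
  have e2 : p = c t.
    by apply: (unfold_inj _ _ e1); [exact: accordion_hull|right; exists j; exact: cb].
  have := accordion_gap u Kp; rewrite e2 -/F /=; case; nra.
- by rewrite /= c0 c1; split; exact: jn.
rewrite /= c0 c1 -!(unfoldE sigma) //; first last.
- exact: legB.
- exact: legB.
apply: image_separates.
  exact: (@segment_accordion _ true (false :: u) _ (segment_vertex u).1).
apply: gap_separates => //; exact: legK.
Qed.

End Invariants.

(** * Coordinates along the two legs at a shared vertex *)

Section Arms.
Local Arguments scale : simpl never.
Context {R : realType}.
Context (sigma : nat -> bool) (j : nat).
Implicit Types (p q : R * R) (b : bool).
Local Notation Y := (@unfolded R sigma).
Local Notation k := j.+1.
Local Notation v := (@entry R j.+1).
Local Notation F := (@gap R (spine j)).

(* The two legs at the vertex [v] issue from the blocks [arm_block false] on its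
   left and [arm_block true] on its right; [arm b eta e] is the image of the point
   at distance [e] from the leg, at height [eta] above [v]. *)
Definition arm_block b := if b then k else j.
Definition arm_step b : R := step (arm_block b).
Definition arm_width b : R := if b then width1 k else width0 j.
Definition arm_sign b : R := sgb (sigma (arm_block b)).
Definition arm_word b := false :: spine (arm_block b).

Local Notation w := arm_step.
Local Notation W := arm_width.
Local Notation s := arm_sign.

Definition arm b (eta e : R) : R * R :=
  (1 - scale k + sgb b * (w b * (eta - W b / 2 * eta + e / 2)),
   hgt k (eta + s b * (e - W b * eta))).

(** The point that the affine map of the block sends to [arm b eta e]; positive [e] points away from
    the hole, into the block. *)
Definition leg_point b (eta e : R) : R * R :=
  (abscissa (pick_side b F) (hgt k eta) + sgb b * e, hgt k eta).

Lemma arm_sizes b : [/\ 0 < w b, 0 < W b & W b <= 2^-1].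
Proof.
have [_ [h1 _] _ [h2 _ h3]] := @block_sizes R k.
have [_ [k1 _] [k2 _ k3] _] := @block_sizes R j.
by rewrite /arm_step /arm_width; case: b; split => //; lra.
Qed.

Lemma arm_sign_cases b : s b = 1 \/ s b = -1.
Proof. exact: sgb_cases. Qed.

Lemma arm_leg_point b eta e :
  arm b eta e = block_map sigma (arm_block b) (leg_point b eta e).
Proof.
have hp2 b' : (leg_point b' eta e).2 = hgt k eta by [].
case: b; set p := leg_point _ eta e.
  have l := left_offset k p.
  have eo : offset k p = e - width1 k * eta.
    by move: l; rewrite hp2 hgtK quad_cons /p /leg_point /gap /=; lra.
  rewrite /arm /block_map /arm_block /arm_step /arm_width /arm_sign /= eo hgtK.
  by congr (_, _); ring.
have hj : hgt j (hgt k eta) = 1 - eta.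
  by have := hgtS j (hgt k eta); rewrite hgtK; lra.
have r := right_offset j p.
have eo : offset j p = width0 j * eta - e.
  by move: r; rewrite hp2 hj /p /leg_point /=; lra.
rewrite /arm /block_map /arm_block /arm_step /arm_width /arm_sign /= eo hj.
have es : scale k = scale j - step j :> R by rewrite /step; ring.
congr (_, _); first by rewrite es; ring.
by rewrite hgtS /hgt; case: (odd j); ring.
Qed.

Lemma arm_word_side b : pick_side (~~ b) (quad (arm_word b)) = pick_side b F.
Proof. by case: b. Qed.

Lemma leg_accordion b eta : 0 <= eta <= 1 ->
  accordion (leg_point b eta 0) /\ inblock (arm_block b) (leg_point b eta 0).
Proof.
move=> he; have hs : segment (pick_side (~~ b) (quad (arm_word b))) (leg_point b eta 0).
  by rewrite arm_word_side; split; rewrite /= ?mulr0 ?addr0 // hgt_in.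
by split; [exact: segment_accordion hs|exact: segment_quad hs].
Qed.

Lemma armE b eta : 0 <= eta <= 1 -> arm b eta 0 = unfold sigma (leg_point b eta 0).
Proof.
by move=> he; rewrite arm_leg_point (unfoldE _ (leg_accordion b he).2).
Qed.

Lemma arm_image b eta : 0 <= eta <= 1 -> Y (arm b eta 0).
Proof.
move=> he; rewrite armE //; exists (leg_point b eta 0) => //.
by case: (leg_accordion b he).
Qed.

Lemma leg_point0 b : leg_point b 0 0 = v.
Proof.
rewrite /leg_point mulr0 addr0 -vertex_spine /vertex size_nseq.
have -> : hgt k 0 = apex j :> R by rewrite /hgt /apex /=; case: (odd j) => /=; lra.
by have := @gap_shared R (spine j); rewrite size_nseq; case: b => /= ->.
Qed.

Lemma arm0 b : arm b 0 0 = v.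
Proof.
by rewrite /arm !mulr0 !subr0 mul0r !addr0 !mulr0 !addr0.
Qed.

Lemma v_accordion : accordion v.
Proof. by rewrite -(leg_point0 true); apply: (leg_accordion _ _).1; rewrite lexx ler01. Qed.

Definition dist b p : R := sgb b * (p.1 - (1 - scale k)).

(** Obtained by eliminating [eta] from the two coordinates of [arm b eta e], which leaves
    [e * (s b - 2^-1)]. It vanishes on the line carrying the arm and tells its two sides apart;
    [arm_e] and [arm_eta] then invert [arm b] on the whole plane. *)
Definition level b p : R :=
  hgt k p.2 * (1 - W b / 2) - (1 - s b * W b) * (dist b p / w b).

Definition arm_e b p : R := level b p / (s b - 2^-1).
Definition arm_eta b p : R := (dist b p / w b - arm_e b p / 2) / (1 - W b / 2).

Lemma sgb_sqr b : sgb b * sgb b = 1 :> R.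
Proof. by case: b; rewrite /= ?mulr1 // mulrNN mulr1. Qed.

Lemma arm_coords b p : arm b (arm_eta b p) (arm_e b p) = p.
Proof.
have [w0 W0 W1] := arm_sizes b.
have nW : 1 - W b / 2 != 0 by apply/eqP; lra.
have ns : s b - 2^-1 != 0 by apply/eqP; case: (arm_sign_cases b) => ->; lra.
have e1 : arm_eta b p - W b / 2 * arm_eta b p + arm_e b p / 2 = dist b p / w b.
  have : arm_eta b p * (1 - W b / 2) = dist b p / w b - arm_e b p / 2.
    by rewrite /arm_eta mulfVK.
  by lra.
have e2 : arm_eta b p + s b * (arm_e b p - W b * arm_eta b p) = hgt k p.2.
  have h : arm_e b p * (s b - 2^-1) = level b p by rewrite /arm_e mulfVK.
  apply: (mulIf nW).
  have : arm_eta b p * (1 - W b / 2) = dist b p / w b - arm_e b p / 2 by lra.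
  move: h; rewrite /level; move: (arm_eta b p) (arm_e b p) (dist b p / w b) => x y d.
  move=> h h2.
  have -> : (x + s b * (y - W b * x)) * (1 - W b / 2) =
    x * (1 - W b / 2) * (1 - s b * W b) + s b * y * (1 - W b / 2) by ring.
  by rewrite h2; lra.
rewrite /arm e1 e2 hgtK [w b * _]mulrC divfK ?gt_eqF //.
have -> : sgb b * dist b p = p.1 - (1 - scale k).
  by rewrite /dist mulrA sgb_sqr mul1r.
by rewrite addrC subrK -surjective_pairing.
Qed.

Lemma dist_arm b eta e : dist b (arm b eta e) = w b * (eta - W b / 2 * eta + e / 2).
Proof. by rewrite /dist /arm /= [X in _ * X]addrC addKr mulrA sgb_sqr mul1r. Qed.

Lemma level_arm b eta e : level b (arm b eta e) = e * (s b - 2^-1).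
Proof.
have [w0 W0 W1] := arm_sizes b.
rewrite /level dist_arm /= hgtK [w b * _]mulrC mulfK ?gt_eqF //.
by field.
Qed.

Lemma arm_e_arm b eta e : arm_e b (arm b eta e) = e.
Proof.
rewrite /arm_e level_arm mulfK //; apply/eqP; case: (arm_sign_cases b) => ->; lra.
Qed.

Lemma arm_eta_arm b eta e : arm_eta b (arm b eta e) = eta.
Proof.
have [w0 W0 W1] := arm_sizes b.
rewrite /arm_eta arm_e_arm dist_arm [w b * _]mulrC mulfK ?gt_eqF // addrK.
have -> : eta - W b / 2 * eta = eta * (1 - W b / 2) by ring.
by rewrite mulfK //; apply/eqP; lra.
Qed.

Lemma continuous_dist b : continuous (dist b).
Proof.
move=> p; apply: cvgM; first exact: cvg_cst.
by apply: cvgB; [exact: cvg_fst|exact: cvg_cst].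
Qed.

Lemma continuous_level b : continuous (level b).
Proof.
move=> p; apply: cvgB; apply: cvgM; try exact: cvg_cst.
  by apply: (@continuous_comp _ _ _ snd (hgt k)); [exact: cvg_snd|exact: continuous_hgt].
by apply: cvgM; [exact: continuous_dist|exact: cvg_cst].
Qed.

Lemma continuous_arm_e b : continuous (arm_e b).
Proof. by move=> p; apply: cvgM; [exact: continuous_level|exact: cvg_cst]. Qed.

Lemma continuous_arm_eta b : continuous (arm_eta b).
Proof.
move=> p; apply: cvgM; last exact: cvg_cst.
apply: cvgB; apply: cvgM; try exact: cvg_cst; first exact: continuous_dist.
exact: continuous_arm_e.
Qed.

Lemma near_leg b eps : 0 < eps -> exists2 c, segment c `<=` accordion &
  [/\ segment c `<=` inblock (arm_block b) &
   forall y, 0 <= y <= 1 ->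
     0 < sgb b * (abscissa c y - abscissa (pick_side b F) y) < eps].
Proof.
move=> eps0; have [n hn] := expr_half_lt eps0.
set u := nseq n (~~ b) ++ arm_word b.
have es : pick_side (~~ b) (quad u) = pick_side b F by rewrite /u quad_nseq arm_word_side.
exists (pick_side b (quad u)); first exact: segment_accordion.
split; first by move=> p /segment_quad /quadrilateral_cat.
move=> y hy; rewrite -es.
have lt := abscissa_lt hy (@quad_lt R u); have le := abscissa_width u hy.
have le' : (2^-1 : R) ^+ size u <= 2^-1 ^+ n.
  by rewrite /u size_cat size_nseq exprD ler_piMr ?exprn_ge0 ?exprn_ile1 //; lra.
have hw := le_lt_trans (le_trans le le') hn.
by case: (b) => /=; apply/andP; split; lra.
Qed.

(* Near an interior point of the leg the accordion accumulates on the side where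
   [s b * level b] is positive, so that side is blocked. *)
Lemma arm_free b (g : R -> R * R) eta : continuous g -> g 0 = arm b eta 0 ->
  0 < eta < 1 -> (forall t, 0 < t < 1 -> ~ Y (g t)) ->
  exists2 t, 0 < t < 2^-1 & 0 < dist b (g t) /\ s b * level b (g t) < 0.
Proof.
move=> cg g0 /andP[eta0 eta1] gY.
have [w0 W0 W1] := arm_sizes b.
have ce : continuous (fun t => arm_e b (g t)).
  by move=> t; apply: continuous_comp; [exact: cg|exact: continuous_arm_e].
have ch : continuous (fun t => arm_eta b (g t)).
  by move=> t; apply: continuous_comp; [exact: cg|exact: continuous_arm_eta].
have cd : continuous (fun t => dist b (g t)).
  by move=> t; apply: continuous_comp; [exact: cg|exact: continuous_dist].
have near0 : \forall t \near (0 : R), 0 < dist b (g t) /\ 0 < arm_eta b (g t) < 1.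
  have h1 : \forall t \near (0 : R), 0 < dist b (g t).
    apply: (cvgr_gt _ (cd 0)); rewrite g0 dist_arm; apply: mulr_gt0 => //; nra.
  have h2 : \forall t \near (0 : R), 0 < arm_eta b (g t).
    by apply: (cvgr_gt _ (ch 0)); rewrite g0 arm_eta_arm.
  have h3 : \forall t \near (0 : R), arm_eta b (g t) < 1.
    by apply: (cvgr_lt _ (ch 0)); rewrite g0 arm_eta_arm.
  by near=> t; split; [near: t|apply/andP; split; near: t].
have [r /= r0 hr] := (nbhs_ballP _ _).1 near0.
(* Staying below 1/2 keeps the times found from the two ends of a path in order. *)
pose t0 := Order.min r 2^-1 / 2.
have m0 : 0 < Order.min r 2^-1 :> R by rewrite lt_min r0; lra.
have t00 : 0 < t0 by rewrite /t0; lra.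
have [t0r t02] : t0 < r /\ t0 < 2^-1.
  have : Order.min r 2^-1 <= r by rewrite ge_min lexx.
  have : Order.min r 2^-1 <= 2^-1 :> R by rewrite ge_min lexx orbT.
  by rewrite /t0; split; lra.
have good t : 0 <= t <= t0 -> 0 < dist b (g t) /\ 0 < arm_eta b (g t) < 1.
  by move=> /andP[h1 h2]; apply: hr; rewrite /ball /= sub0r normrN ger0_norm //; lra.
have t0I : 0 <= t0 <= t0 by apply/andP; split; lra.
have [d0 /andP[y0 y1]] := good _ t0I.
exists t0; first by rewrite t00 t02.
split => //; rewrite ltNge; apply/negP => lv.
have e0 : 0 <= arm_e b (g t0).
  rewrite /arm_e; move: lv; case: (arm_sign_cases b) => -> lv.
    by have -> : (1 - 2^-1)^-1 = 2 :> R; [field|lra].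
  by have -> : (- 1 - 2^-1)^-1 = - (2 / 3) :> R; [field|lra].
have [e00|e00] := eqVneq (arm_e b (g t0)) 0.
  apply: (gY t0); first by apply/andP; split; lra.
  by rewrite -(arm_coords b (g t0)) e00; apply: arm_image; rewrite !ltW.
have e1 : 0 < arm_e b (g t0) by rewrite lt_neqAle eq_sym e00.
(* If the path went to the blocked side, some side [c] of a quadrilateral would be closer to the leg
   than [g t0]. The function [f] below compares the distances of the path and of [c] to the leg; a
   zero is a crossing with the image of [c]. *)
have [c cK [cB cl]] := near_leg b e1.
pose gapc y := sgb b * (abscissa c y - abscissa (pick_side b F) y).
have cgap : continuous gapc.
  move=> y; apply: cvgM; first exact: cvg_cst.
  by apply: cvgB; exact: continuous_abscissa.
pose f t := arm_e b (g t) - gapc (hgt k (arm_eta b (g t))).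
have cf : continuous f.
  move=> t; apply: cvgB; first exact: ce.
  apply: (@continuous_comp _ _ _ (fun t => hgt k (arm_eta b (g t))) gapc); last exact: cgap.
  apply: (@continuous_comp _ _ _ (fun t => arm_eta b (g t)) (hgt k)); first exact: ch.
  exact: continuous_hgt.
have hgood t : 0 <= t <= t0 -> 0 <= hgt k (arm_eta b (g t)) <= 1.
  by move=> /good[_ /andP[h1 h2]]; rewrite hgt_in !ltW.
have f0 : f 0 < 0.
  have h : 0 <= (0 : R) <= t0 by rewrite lexx ltW.
  have /andP[h1 _] := cl _ (hgood _ h).
  by rewrite /f {1}g0 arm_e_arm sub0r oppr_lt0.
have ft : 0 < f t0.
  by have /andP[_ h1] := cl _ (hgood _ t0I); rewrite /f subr_gt0.
have [|t tI ftz] := @IVT R f 0 t0 0 (ltW t00) (continuous_subspaceT cf).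
  by rewrite ge_min le_max (ltW f0) (ltW ft) orbT.
move: tI; rewrite in_itv /= => tI; have /andP[tI1 tI2] := tI.
have tn0 : t != 0 by apply/eqP => tz; move: f0 ftz; rewrite tz => + f00; rewrite f00 ltxx.
have tpos : 0 < t by rewrite lt_neqAle eq_sym tn0.
apply: (gY t); first by apply/andP; split; lra.
have [_ /andP[z0 z1]] := good _ tI.
set y := hgt k (arm_eta b (g t)).
have mem : segment c (abscissa c y, y) by split => //=; exact: hgood.
exists (abscissa c y, y); first exact: cK.
rewrite (unfoldE _ (cB _ mem)) -[RHS](arm_coords b) arm_leg_point; congr block_map.
have -> : arm_e b (g t) = gapc y by move: ftz; rewrite /f -/y; lra.
by rewrite /leg_point -/y /gapc mulrA sgb_sqr mul1r addrC subrK.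
Unshelve. all: by end_near. Qed.

End Arms.

(** * Vertices shared by two blocks of equal signs are facing *)

Section Joins.
Context {R : realType}.
Local Arguments scale : simpl never.
Local Arguments arm_width : simpl never.
Context (sigma : nat -> bool) (j : nat).
Implicit Types (p q : R * R) (b : bool).
Local Notation Y := (@unfolded R sigma).
Local Notation k := j.+1.
Local Notation v := (@entry R j.+1).
Local Notation F := (@gap R (spine j)).
Local Notation w := (@arm_step R j).
Local Notation W := (@arm_width R j).
Local Notation s := (@arm_sign R sigma j).
Local Notation arm := (@arm R sigma j).
Local Notation leg_point := (@leg_point R j).

(** The images of the blocks occupy successive vertical strips, so the abscissa of an image point
    reveals the block. *)
Lemma block_of_x i p : accordion p ->
  1 - scale i <= (unfold sigma p).1 < 1 - scale i.+1 -> inblock i p.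
Proof.
move=> Kp /andP[h1 h2]; case: (accordion_cases Kp) => [[p1 _]|[m hm]].
  by move: h2; rewrite unfold_side1 // p1 => h2; have := @scale_gt0 R i.+1; lra.
rewrite (unfoldE _ hm) in h1 h2.
have [/andP[m1 m2] m3 m4] := block_map_x sigma hm.
have [mi|im|<- //] := ltngtP m i.
- have sc := @scale_lt R _ _ mi.
  have pe : p = entry m.+1 by apply: m4; lra.
  move: h1; rewrite pe block_map_exit /= => h1.
  have e : m.+1 = i.
    apply/eqP; rewrite eqn_leq mi leqNgt; apply/negP => mi2.
    have := @scale_lt R _ _ mi2.
    by have [_ [+ _] _ _] := @block_sizes R m.+1; rewrite /step; lra.
  rewrite e; apply/inblockP; have [-> ->] := @entry_coord R i.
  have [_ _ [s5 _ _] _] := @block_sizes R i.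
  by split; apply/andP; split; rewrite ?mulr0 ?subr0 ?mulr1 ?oppr0; lra.
- by have sc := @scale_lt R _ _ im; lra.
Qed.

Lemma inblock_leg_point b p : inblock (arm_block j b) p ->
  exists eta e, 0 <= e /\ p = leg_point b eta e.
Proof.
move=> [hy /andP[h1 h2]].
exists (hgt k p.2), (sgb b * (p.1 - abscissa (pick_side b F) p.2)).
split; last first.
  by rewrite /leg_point hgtK mulrA sgb_sqr mul1r addrC subrK -surjective_pairing.
by case: b h1 h2 => /=; lra.
Qed.

Lemma leg_point_continuous b : continuous (fun eta => leg_point b eta 0).
Proof.
apply: continuous_pair; last exact: continuous_hgt.
move=> eta; apply: cvgD; last exact: cvg_cst.
apply: (@continuous_comp _ _ _ (hgt k) (abscissa (pick_side b F))).
  exact: continuous_hgt.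
exact: continuous_abscissa.
Qed.

Lemma leg_pointK b eta : leg_point b eta 0 = v -> eta = 0.
Proof. by move=> [_ /(can_inj (hgtK j.+1))]. Qed.

Lemma legs_separates eta : 0 < eta <= 1 ->
  separates accordion v (leg_point false eta 0) (leg_point true eta 0).
Proof.
move=> /andP[h0 h1]; have he : 0 <= eta <= 1 by rewrite h1 ltW.
have nv b : leg_point b eta 0 <> v by move=> /leg_pointK e; rewrite e ltxx in h0.
rewrite -vertex_spine; apply: gap_separates; rewrite ?vertex_spine //.
- exact: (leg_accordion _ _ he).1.
- exact: (leg_accordion _ _ he).1.
- by rewrite /= mulr0 addr0.
- by rewrite /= mulr0 addr0.
Qed.

Lemma same_leg_not_separates b eta eta' : 0 < eta <= 1 -> 0 < eta' <= 1 ->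
  ~ separates accordion v (leg_point b eta 0) (leg_point b eta' 0).
Proof.
move=> /andP[a0 a1] /andP[b0 b1] [xv zv [A [B [cA cB AB iAB [Ax Bz]]]]].
suff Az : A (leg_point b eta' 0).
  by apply: zv; have : (A `&` B) (leg_point b eta' 0) by []; rewrite iAB.
pose C := (fun h => leg_point b h 0) @` `[Order.min eta eta', Order.max eta eta'].
apply: (@connected_closed_cover _ C A B (leg_point b eta 0)) => //.
- apply: connected_continuous_connected; first exact: segment_connected.
  by apply: continuous_subspaceT; exact: leg_point_continuous.
- move=> _ [h hI <-]; rewrite AB; apply: (leg_accordion _ _ _).1.
  move: hI; rewrite /= in_itv /= ge_min le_max => /andP[h1 h2].
  by apply/andP; split; [case/orP: h1|case/orP: h2]; lra.
- move=> _ [h hI <-] At Bt.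
  have : (A `&` B) (leg_point b h 0) by [].
  rewrite iAB => /leg_pointK h0; move: hI.
  by rewrite h0 /= in_itv /= ge_min => /andP[/orP[]]; lra.
- by exists eta; rewrite //= in_itv /= ge_min le_max !lexx.
- by exists eta'; rewrite //= in_itv /= ge_min le_max !lexx !orbT.
Qed.

Lemma arms_separate eta : 0 < eta <= 1 -> separates Y v (arm false eta 0) (arm true eta 0).
Proof.
move=> he; have he' : 0 <= eta <= 1 by case/andP: he => h1 h2; rewrite h2 ltW.
rewrite !armE // -{1}(unfold_entry sigma k).
apply: image_separates; first exact: v_accordion.
exact: legs_separates.
Qed.

(** With equal signs the free sides of both arms are on the same side, above or below, of the broken
    line that they form, so a path can run alongside it past [v]. *)
Lemma facing_join : sigma j = sigma k -> facing Y v.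
Proof.
move=> es; have ess b : s b = s true by case: b; rewrite // /arm_sign /= es.
set S := s true in ess.
have S1 : S = 1 \/ S = -1 by exact: arm_sign_cases.
move=> N /nbhs_ballP[e /= e0 he].
pose a := Order.min e 1 / 4.
have m0 : 0 < Order.min e 1 by rewrite lt_min e0 ltr01.
have a0 : 0 < a by rewrite /a; lra.
have [ae a1] : a * 4 <= e /\ a * 4 <= 1.
  have : Order.min e 1 <= e by rewrite ge_min lexx.
  have : Order.min e 1 <= 1 by rewrite ge_min lexx orbT.
  by rewrite /a; split; lra.
have [wf0 Wf0 Wf1] := @arm_sizes R j false; have [wt0 Wt0 Wt1] := @arm_sizes R j true.
have ws b : w b <= 1.
  have [_ [_ h1] _ _] := @block_sizes R k; have [[_ h0 _] [_ h2] _ _] := @block_sizes R j.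
  have [[_ h3 _] _ _ _] := @block_sizes R k.
  by rewrite /arm_step; case: b => /=; lra.
have inN p : `|p.1 - (1 - scale k)| <= a -> `|hgt k p.2| <= 2 * a -> N p.
  move=> h1 h2; apply: he; split; rewrite /ball /=.
    by rewrite distrC; apply: (le_lt_trans h1); lra.
  have -> : `|hgt k 0 - p.2| = `|hgt k p.2|.
    rewrite /hgt; case: odd; first by rewrite sub0r normrN.
    by rewrite subr0.
  by apply: (le_lt_trans h2); lra.
(* [mp] and [mm] are the positive and negative parts of [2 * t - 1]. The path follows the arms at
   parameter [a] times the absolute value of [2 * t - 1], displaced vertically towards the free side
   by an amount that vanishes at both ends only. *)
pose mp (t : R) := (`|2 * t - 1| + (2 * t - 1)) / 2.
pose mm (t : R) := (`|2 * t - 1| - (2 * t - 1)) / 2.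
pose X t := 1 - scale k +
  a * (w true * (1 - W true / 2) * mp t - w false * (1 - W false / 2) * mm t).
pose H t := a * ((1 - S * W true) * mp t + (1 - S * W false) * mm t) - S * a * (1 - `|2 * t - 1|).
pose g t : R * R := (X t, hgt k (H t)).
have side t : exists b, [/\ dist j b (g t) = w b * (1 - W b / 2) * (a * `|2 * t - 1|),
    H t = (1 - S * W b) * (a * `|2 * t - 1|) - S * a * (1 - `|2 * t - 1|),
    b -> 0 <= 2 * t - 1 & ~~ b -> 2 * t - 1 < 0].
  have [h|h] := lerP 0 (2 * t - 1).
    exists true; split => //; rewrite /dist /= /X /H /mp /mm (ger0_norm h).
      by field.
    by field.
  exists false; split => //; rewrite /dist /= /X /H /mp /mm (ltr0_norm h).
    by field.
  by field.
have absb b x : `|sgb b * x| = `|x| :> R.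
  by case: b; rewrite /= ?mul1r // mulN1r normrN.
have g0 : g 0 = arm false a 0.
  rewrite /g /arm /X /H /mp /mm !mulr0 !sub0r normrN normr1 ess /=.
  by congr (_, _); [|congr hgt]; lra.
have g1 : g 1 = arm true a 0.
  have e1 : 2 * 1 - 1 = 1 :> R by lra.
  rewrite /g /arm /X /H /mp /mm !e1 normr1 ess /=.
  by congr (_, _); [|congr hgt]; lra.
have armN b eta : 0 <= eta <= a -> N (arm b eta 0).
  move=> /andP[h0 h1]; have [w0 W0 W1] := @arm_sizes R j b.
  have wb := ws b.
  apply: inN.
    have -> : (arm b eta 0).1 - (1 - scale k) = sgb b * (w b * (1 - W b / 2) * eta).
      by rewrite /arm /=; ring.
    rewrite absb ger0_norm; last by apply: mulr_ge0 => //; apply: mulr_ge0; lra.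
    have : w b * (1 - W b / 2) <= 1 by nra.
    by nra.
  rewrite /= hgtK ess ler_norml; apply/andP.
  by case: S1 => ->; split; nra.
have jn b : joined Y N v (arm b a 0).
  exists ((fun eta => arm b eta 0) @` `[0, a]); split.
  - apply: connected_continuous_connected; first exact: segment_connected.
    apply: continuous_subspaceT => eta.
    rewrite /continuous_at; under eq_fun do rewrite arm_leg_point.
    rewrite arm_leg_point.
    apply: (@continuous_comp _ _ _ (fun eta => leg_point b eta 0) (block_map sigma _)).
      exact: leg_point_continuous.
    exact: continuous_block_map.
  - move=> _ [eta hI <-]; move: hI; rewrite /= in_itv /= => hI; split; last exact: armN.
    by apply: arm_image; case/andP: hI => h1 h2; apply/andP; split; lra.
  - by exists 0; rewrite ?arm0 //= in_itv /= lexx ltW.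
  - by exists a; rewrite //= in_itv /= lexx ltW.
have cn : continuous (fun t : R => `|2 * t - 1|).
  move=> t; apply: cvg_norm; apply: cvgB; last exact: cvg_cst.
  by apply: cvgM; [exact: cvg_cst|exact: cvg_id].
have cl : continuous (fun t : R => 2 * t - 1).
  move=> t; apply: cvgB; last exact: cvg_cst.
  by apply: cvgM; [exact: cvg_cst|exact: cvg_id].
have cp : continuous mp.
  by move=> t; apply: cvgM; last exact: cvg_cst; apply: cvgD; [exact: cn|exact: cl].
have cm : continuous mm.
  by move=> t; apply: cvgM; last exact: cvg_cst; apply: cvgB; [exact: cn|exact: cl].
have cH : continuous H.
  move=> t; apply: cvgB; (apply: cvgM; first exact: cvg_cst); last first.
    by apply: cvgB; [exact: cvg_cst|exact: cn].
  by apply: cvgD; (apply: cvgM; first exact: cvg_cst); [exact: cp|exact: cm].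
exists g; split.
- apply: continuous_pair => t.
    apply: cvgD; first exact: cvg_cst.
    apply: cvgM; first exact: cvg_cst.
    by apply: cvgB; (apply: cvgM; first exact: cvg_cst); [exact: cp|exact: cm].
  by apply: (@continuous_comp _ _ _ H (hgt k)); [exact: cH|exact: continuous_hgt].
- clear cn cl cp cm cH jn armN g0 g1 he.
  move=> t /andP[t0 t1]; have [b [hd hH _ _]] := side t; clear side.
  have hn : 0 <= `|2 * t - 1| <= 1 by rewrite normr_ge0 ler_norml; apply/andP; split; lra.
  move: hd hH; move: (`|2 * t - 1|) hn => r /andP[r0 r1] hd hH.
  have [w0 W0 W1] := @arm_sizes R j b; have wb := ws b.
  have ar0 : 0 <= a * r <= a by apply/andP; split; nra.
  case/andP: ar0 => ar0 ar1; apply: inN.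
    have -> : `|(g t).1 - (1 - scale k)| = `|dist j b (g t)| by rewrite /dist absb.
    rewrite hd ger0_norm; last by apply: mulr_ge0 => //; apply: mulr_ge0; lra.
    have : w b * (1 - W b / 2) <= 1 by nra.
    by move: (w b * _) => z zz; nra.
  rewrite /= hgtK hH ler_norml; apply/andP.
  by case: S1 => ->; split; nra.
- clear cn cl cp cm cH jn armN g0 g1 he inN ws absb.
  move=> t /andP[t0 t1] [p Kp e1].
  have [b [hd hH bt bf]] := side t; clear side.
  have hn : 0 <= `|2 * t - 1| < 1 by rewrite normr_ge0 ltr_norml; apply/andP; split; lra.
  have hneg : ~~ b -> 0 < `|2 * t - 1| by move/bf => h; rewrite normr_gt0 lt_eqF.
  move: hd hH hneg; move: (`|2 * t - 1|) hn => r /andP[r0 r1] hd hH hneg.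
  have [w0 W0 W1] := @arm_sizes R j b.
  have hr : a * r < 1 by nra.
  have ar0 : 0 <= a * r by apply: mulr_ge0; lra.
  have hb : inblock (arm_block j b) p.
    apply: block_of_x => //; rewrite e1.
    have d1 : w b * (1 - W b / 2) * (a * r) < w b.
      by rewrite -mulrA gtr_pMr //; nra.
    have d0 : 0 <= w b * (1 - W b / 2) * (a * r).
      by apply: mulr_ge0 => //; apply: mulr_ge0; lra.
    have d2 : ~~ b -> 0 < w b * (1 - W b / 2) * (a * r).
      by move=> nb; apply: mulr_gt0; apply: mulr_gt0; rewrite ?hneg //; lra.
    move: hd d0 d1 d2; move: (w b * _ * _) => z; rewrite /dist /arm_step.
    rewrite /step; case: (b) => /= hd d0 d1 d2.
      by apply/andP; split; lra.
    by have d2' := d2 isT; apply/andP; split; lra.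
  have [eta [e' [e'0 pe]]] := inblock_leg_point hb.
  have ga : g t = arm b eta e' by rewrite -e1 (unfoldE _ hb) pe -arm_leg_point.
  (* A point of the copy in this strip has nonnegative [e'], so [S] times its level is nonnegative;
     the displacement makes it negative. *)
  have l1 : level sigma j b (g t) = e' * (s b - 2^-1) by rewrite ga level_arm.
  have l2 : level sigma j b (g t) = - S * (a * (1 - r)) * (1 - W b / 2).
    rewrite /level hd /= hgtK hH ess [w b * _ * _]mulrC -[w b * _]mulrC mulrA.
    by rewrite mulfK ?gt_eqF //; ring.
  have : 0 < (a * (1 - r)) * (1 - W b / 2) by apply: mulr_gt0; [apply: mulr_gt0|]; lra.
  move: l1; rewrite l2 ess -mulrA; move: (a * (1 - r) * _) => z.
  by case: S1 => ->; nra.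
- by rewrite g0 g1.
- by rewrite g0 g1; apply: arms_separate; apply/andP; split; lra.
Qed.

End Joins.

(** * The non-facing cut points *)

Section SpecialPoints.
Context {R : realType}.
Local Arguments scale : simpl never.
Local Arguments arm_width : simpl never.
Context (sigma : nat -> bool).
Implicit Types (p q : R * R) (b : bool) (j : nat).
Local Notation Y := (@unfolded R sigma).

Lemma unfold_height p : accordion p -> `|(unfold sigma p).2 - p.2| <= 2^-1.
Proof.
move=> Kp; case: (accordion_cases Kp) => [[p1 _]|[j hj]].
  by rewrite unfold_side1 // subrr normr0 invr_ge0.
rewrite (unfoldE _ hj) /block_map [X in X - _]/=.
have [/andP[y0 y1] /andP[h1 h2]] := (inblockP j p).1 hj.
have [_ _ [s5 s6 s7] [s8 s9 s10]] := @block_sizes R j.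
have hD : `|offset j p| <= 2^-1 by rewrite ler_norml; apply/andP; split; nra.
set D := offset j p in hD *.
have -> : `|hgt j (hgt j p.2 + sgb (sigma j) * D) - p.2| = `|sgb (sigma j) * D|.
  rewrite /hgt; case: (odd j); first by congr `|_|; lra.
  by rewrite -normrN; congr `|_|; lra.
by case: (@sgb_cases R (sigma j)) => ->; rewrite ?mul1r ?mulN1r ?normrN.
Qed.

(** A quadrilateral resting on the leg and thin enough separates it from [p] at the height of [p].
    The parity of its word is adjusted so that its zigzag has its vertex at the height opposite to
    that of [entry j.+1]. *)
Lemma far_from_leg j b p : accordion p ->
  0 < sgb b * (p.1 - abscissa (pick_side b (@gap R (spine j))) p.2) ->
  exists u, apex (size u) = hgt j.+1 1 :> R /\ forall y : R, 0 <= y <= 1 ->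
    (0 < sgb b * (abscissa (@gap R u).1 y - abscissa (pick_side b (@gap R (spine j))) y) /\
     0 < sgb b * (abscissa (@gap R u).2 y - abscissa (pick_side b (@gap R (spine j))) y)) /\
    (0 < sgb b * (p.1 - abscissa (@gap R u).1 p.2) /\
     0 < sgb b * (p.1 - abscissa (@gap R u).2 p.2)).
Proof.
set L := pick_side b _ => Kp d0; have hp := accordion_height Kp.
have [n hn] := expr_half_lt d0.
have [u [eu su par]] : exists u, [/\ pick_side (~~ b) (@quad R u) = L,
    (n <= size u)%N & odd (size u) = ~~ odd j].
  pose word m := nseq m (~~ b) ++ arm_word j b.
  have ew m : pick_side (~~ b) (@quad R (word m)) = L.
    by rewrite /word quad_nseq arm_word_side.
  have sw m : size (word m) = (m + (arm_block j b).+1)%N.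
    by rewrite size_cat size_nseq /= size_nseq.
  have [par|par] := eqVneq (odd (size (word n))) (~~ odd j).
    by exists (word n); split => //; rewrite sw leq_addr.
  exists (word n.+1); split => //; first by rewrite sw addSn leqW // leq_addr.
  by move: par; rewrite !sw addSn /=; case: (odd (n + _)); case: (odd j).
exists u; split.
  by rewrite /apex /hgt /= par; case: (odd j) => /=; lra.
move=> y hy; rewrite -eu in d0 hn *.
have le := abscissa_width u hp.
have le' : (2^-1 : R) ^+ size u <= 2^-1 ^+ n.
  by rewrite ler_wiXn2l //; lra.
have hw := le_lt_trans (le_trans le le') hn.
have a1 := abscissa_lt hy (@gap_gt R u); have a2 := abscissa_le hy (@gap_le R u).
have a3 := abscissa_lt hy (@gap_lt R u).
have b1 := abscissa_lt hp (@gap_gt R u); have b2 := abscissa_le hp (@gap_le R u).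
have b3 := abscissa_lt hp (@gap_lt R u).
by case: (b) d0 hw => /= d0 hw; split; split; lra.
Qed.

(** Unfolding changes heights by at most 1/2, so the preimage stays below 3/4. There the zigzag of
    [far_from_leg] does not reach its vertex and cuts the accordion into two disjoint closed pieces;
    a connected set containing the shared vertex cannot leave the legs. *)
Lemma joined_leg j q : joined Y [set q | hgt j.+1 q.2 < 4^-1] (entry j.+1) q ->
  q <> entry j.+1 -> exists b eta, 0 < eta < 1 /\ q = arm sigma j b eta 0.
Proof.
case=> A [cA AY Av Aq] qv.
have [[p Kp ep] hq] := AY _ Aq.
have low (r : R * R) : accordion r -> hgt j.+1 (unfold sigma r).2 < 4^-1 -> hgt j.+1 r.2 <= 3 / 4.
  move=> Kr; have := unfold_height Kr; rewrite ler_norml /hgt => /andP[h1 h2].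
  by case: (odd j.+1); lra.
have lowp : hgt j.+1 p.2 <= 3 / 4 by apply: low => //; rewrite ep.
have hp := accordion_height Kp.
suff [b e] : exists b, p.1 = abscissa (pick_side b (gap (spine j))) p.2.
  exists b, (hgt j.+1 p.2).
  have pl : p = leg_point j b (hgt j.+1 p.2) 0.
    by rewrite /leg_point hgtK mulr0 addr0 -e -surjective_pairing.
  have /andP[h0 h1] : 0 <= hgt j.+1 p.2 <= 1 by rewrite hgt_in.
  have he : 0 <= hgt j.+1 p.2 <= 1 by rewrite h0 h1.
  have qa : q = arm sigma j b (hgt j.+1 p.2) 0 by rewrite armE // -pl.
  split => //; apply/andP; split; last lra.
  rewrite lt_neqAle h0 andbT; apply/eqP => h; apply: qv.
  by rewrite qa -h arm0.
apply: contrapT => nb.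
have [b d0] : exists b, 0 < sgb b * (p.1 - abscissa (pick_side b (gap (spine j))) p.2).
  case: (accordion_gap (spine j) Kp) => h.
    exists false; rewrite /= mulN1r opprB subr_gt0 lt_neqAle h andbT.
    by apply/eqP => e; apply: nb; exists false.
  exists true; rewrite /= mul1r subr_gt0 lt_neqAle h andbT.
  by apply/eqP => e; apply: nb; exists true.
have [u [au hu]] := far_from_leg Kp d0.
have clow : closed [set r : R * R | hgt j.+1 r.2 <= 3 / 4].
  apply: continuous_closed_le => r; last exact: cvg_cst.
  by apply: (@continuous_comp _ _ _ snd (hgt j.+1)); [exact: cvg_snd|exact: continuous_hgt].
pose C d : set (R * R) := [set r | hgt j.+1 r.2 <= 3 / 4] `&`
  (if d then [set r | abscissa (gap u).2 r.2 <= r.1] else [set r | r.1 <= abscissa (gap u).1 r.2]).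
have cC d : closed (unfold sigma @` (accordion `&` C d)).
  apply: (closed_image compact_accordion (@continuous_unfold R sigma)).
  apply: closedI => //; case: d; apply: continuous_closed_le => r;
    by [exact: cvg_fst|exact: continuous_abscissa2].
have dis t : (unfold sigma @` (accordion `&` C true)) t ->
    (unfold sigma @` (accordion `&` C false)) t -> False.
  case=> r [Kr [/= l1 r1]] <- [r' [Kr' [/= l2 r2]]] /(unfold_accordion_inj Kr' Kr) e.
  subst r'; have hr := accordion_height Kr.
  have e1 : r = vertex u by apply: vertexP.
  by move: l1; rewrite e1 /= au hgtK; lra.
have cov : A `<=` (unfold sigma @` (accordion `&` C b)) `|`
    (unfold sigma @` (accordion `&` C (~~ b))).
  move=> t /AY[[r Kr <-] hr]; have lr := low _ Kr hr.
  have [h|h] := accordion_gap u Kr.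
    by case: (b); [right|left]; exists r.
  by case: (b); [left|right]; exists r.
have vK := @v_accordion R j.
have hv0 : hgt j.+1 (@entry R j.+1).2 = 0 by rewrite /= hgtK.
have hvI : 0 <= (@entry R j.+1).2 <= 1 by rewrite -(hgt_in j.+1) hv0 lexx ler01.
have [[hu1 hu2] [hp1 hp2]] := hu _ hvI.
have vleg : (@entry R j.+1).1 = abscissa (pick_side b (gap (spine j))) (entry j.+1).2.
  by rewrite -{1}(leg_point0 j b) /leg_point /= mulr0 addr0.
rewrite -vleg in hu1 hu2.
have inC b' t (r : R * R) : accordion r -> t = unfold sigma r -> hgt j.+1 r.2 <= 3 / 4 ->
    0 <= sgb b' * (r.1 - abscissa (pick_side b' (gap u)) r.2) ->
    (unfold sigma @` (accordion `&` C b')) t.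
  move=> Kr -> lr h; exists r => //; split => //; split => //.
  by case: b' h => /=; lra.
have inp : (unfold sigma @` (accordion `&` C b)) q.
  by apply: (inC b q p) => //; case: (b) hp1 hp2 => /= hp1 hp2; lra.
have inve : (unfold sigma @` (accordion `&` C (~~ b))) (entry j.+1).
  apply: (inC (~~ b) _ (entry j.+1)) => //; first by rewrite unfold_entry.
    by rewrite hv0; lra.
  by move: (entry j.+1) hu1 hu2 => r; case: (b) => /= hu1 hu2; lra.
have := @connected_closed_cover _ A _ _ q (entry j.+1) cA (cC b) (cC (~~ b)) cov.
have dis' t : A t -> (unfold sigma @` (accordion `&` C b)) t ->
    (unfold sigma @` (accordion `&` C (~~ b))) t -> False.
  by move=> _; case: (b) => h1 h2; [apply: (dis t)|apply: (dis t)].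
move=> /(_ dis' Aq inp Av) inv2.
exact: (dis' _ Av inv2 inve).
Qed.

(** By [arm_free] the path leaves each leg on its free side. With opposite signs one of these is
    above the broken line formed by the arms and the other below, so the path has to cross that
    line. *)
Lemma not_facing_join j : sigma j <> sigma j.+1 -> ~ facing Y (entry j.+1).
Proof.
move=> ns /(_ [set q | hgt j.+1 q.2 < 4^-1]) [].
  apply: open_nbhs_nbhs; split; last by rewrite /= hgtK invr_gt0.
  apply: continuous_open_lt => r; last exact: cvg_cst.
  by apply: (@continuous_comp _ _ _ snd (hgt j.+1)); [exact: cvg_snd|exact: continuous_hgt].
move=> g [cg gN gY [j0 j1] sep].
have [n0 n1 _] := sep.
have [b0 [e0 [he0 g0]]] := joined_leg j0 n0.
have [b1 [e1 [he1 g1]]] := joined_leg j1 n1.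
have I0 : 0 < e0 <= 1 by case/andP: he0 => h1 h2; rewrite h1 ltW.
have I1 : 0 < e1 <= 1 by case/andP: he1 => h1 h2; rewrite h1 ltW.
have I0' : 0 <= e0 <= 1 by case/andP: he0 => h1 h2; rewrite !ltW.
have I1' : 0 <= e1 <= 1 by case/andP: he1 => h1 h2; rewrite !ltW.
have [eb|nb] := eqVneq b0 b1.
  subst b1; apply: (@same_leg_not_separates R j b0 e0 e1) => //.
  apply: (separates_preimage compact_accordion (@continuous_unfold R sigma)
    (@unfold_accordion_inj R sigma)).
  - exact: v_accordion.
  - exact: (leg_accordion _ _ I0').1.
  - exact: (leg_accordion _ _ I1').1.
  - by rewrite unfold_entry -!armE // -g0 -g1.
have sN : arm_sign sigma j b1 = - arm_sign sigma j b0 :> R.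
  have ns' : sigma j.+1 = ~~ sigma j.
    by case: (sigma j) (sigma j.+1) ns => -[] ns //; case: ns.
  have sg (c : bool) : sgb (~~ c) = - sgb c :> R by case: c; rewrite /= ?opprK.
  have -> : b1 = ~~ b0 by case: b0 b1 nb {g0 g1} => -[].
  by rewrite /arm_sign /arm_block; case: (b0) => /=; rewrite ns' sg ?opprK.
have [t0 /andP[t00 t01] [d0 l0]] := arm_free cg g0 he0 gY.
have cg' : continuous (fun t : R => g (1 - t)).
  move=> t; apply: (@continuous_comp _ _ _ (fun t : R => 1 - t) g); last exact: cg.
  by apply: cvgB; [exact: cvg_cst|exact: cvg_id].
have g0' : (fun t : R => g (1 - t)) 0 = arm sigma j b1 e1 0 by rewrite /= subr0.
have gY' (t : R) : 0 < t < 1 -> ~ Y (g (1 - t)).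
  by move=> /andP[h1 h2]; apply: gY; apply/andP; split; lra.
have [t1 /andP[t10 t11] [d1 l1]] := arm_free cg' g0' he1 gY'.
pose W := @arm_width R j; pose w := @arm_step R j; pose s := @arm_sign R sigma j.
(* [m b] is the slope of arm [b], and [G] the height above the broken line; on the side of arm [b]
   it is [level] up to the positive factor [1 - W b / 2]. *)
pose m b := (1 - s b * W b) / (w b * (1 - W b / 2)).
pose X p := p.1 - (1 - scale j.+1) : R.
pose G p := hgt j.+1 p.2 - m true * ((`|X p| + X p) / 2) - m false * ((`|X p| - X p) / 2).
have Gl b p : 0 <= dist j b p -> G p * (1 - W b / 2) = level sigma j b p.
  have [w0 W0 W1] := @arm_sizes R j b.
  have e : m b * (1 - W b / 2) = (1 - s b * W b) / w b.
    rewrite /m invfM mulrA mulfVK //; apply/eqP; rewrite /W; lra.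
  rewrite /level /dist -/(X p) /G -/(W b) -/(s b) -/(w b) => hX.
  have eG : G p = hgt j.+1 p.2 - m b * (sgb b * X p).
    rewrite /G; case: (b) hX => /= hX.
      by rewrite ger0_norm; [field|lra].
    by rewrite ler0_norm; [field|lra].
  rewrite -/(G p) eG mulrBl [m b * _ * _]mulrAC e.
  by ring.
have cX : continuous X by move=> p; apply: cvgB; [exact: cvg_fst|exact: cvg_cst].
have cnX : continuous (fun p => `|X p|) by move=> p; apply: cvg_norm; exact: cX.
have cG : continuous G.
  move=> p; apply: cvgB.
    apply: cvgB.
      by apply: (@continuous_comp _ _ _ snd (hgt j.+1)); [exact: cvg_snd|exact: continuous_hgt].
    apply: cvgM; first exact: cvg_cst; apply: cvgM; last exact: cvg_cst.
    by apply: cvgD; [exact: cnX|exact: cX].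
  apply: cvgM; first exact: cvg_cst; apply: cvgM; last exact: cvg_cst.
  by apply: cvgB; [exact: cnX|exact: cX].
have cGg : continuous (fun t => G (g t)).
  by move=> t; apply: continuous_comp; [exact: cg|exact: cG].
have sgn b p : 0 < dist j b p -> s b * level sigma j b p < 0 -> s b * G p < 0.
  move=> hd; rewrite -(Gl b p (ltW hd)) mulrA; have [_ _ W1] := @arm_sizes R j b.
  by rewrite pmulr_llt0 // /W; lra.
have s0 := sgn _ _ d0 l0; have s1 := sgn _ _ d1 l1.
have [t tI Gt] : exists2 t, t \in `[t0, 1 - t1] & G (g t) = 0.
  apply: (@IVT R (fun t : R => G (g t)) t0 (1 - t1) 0); [lra|exact: continuous_subspaceT|].
  move: s0 s1; rewrite /s sN ge_min le_max /=.
  case: (@arm_sign_cases R sigma j b0) => -> h1 h2; apply/andP; split; apply/orP;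
    first [by left; lra|by right; lra].
move: tI; rewrite in_itv /= => /andP[ta tb].
apply: (gY t); first by apply/andP; split; lra.
have [b hb] : exists b, 0 <= dist j b (g t).
  rewrite /dist; have [h|h] := lerP 0 ((g t).1 - (1 - scale j.+1)).
    by exists true; rewrite /= mul1r.
  by exists false; rewrite /= mulN1r; lra.
have lv : level sigma j b (g t) = 0 by rewrite -(Gl b) // Gt mul0r.
have ez : arm_e sigma j b (g t) = 0 by rewrite /arm_e lv mul0r.
have [w0 W0 W1] := @arm_sizes R j b.
rewrite -(arm_coords sigma j b (g t)) ez; apply: arm_image.
have eta0 : 0 <= arm_eta sigma j b (g t).
  rewrite /arm_eta ez mul0r subr0; apply: divr_ge0; last lra.
  by apply: divr_ge0 => //; exact: ltW.
rewrite eta0 /=.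
(* On arm [b] the height is [eta * (1 - s b * W b)] with [W b <= 2^-1]; below 1/4 it forces [eta]
   below 1/2, so the crossing is on the leg and not on its prolongation. *)
have h4 : hgt j.+1 (g t).2 < 4^-1 by apply: gN; apply/andP; split; lra.
have := arm_coords sigma j b (g t); rewrite ez /arm => /(congr1 snd) /= /(congr1 (hgt j.+1)).
rewrite hgtK => eh; rewrite -eh in h4; move: h4 eta0.
by move: (arm_eta _ _ _ _) => x; case: (@arm_sign_cases R sigma j b) => ->; nra.
Qed.

Lemma specialE q : special Y q <-> exists j, sigma j <> sigma j.+1 /\ q = entry j.+1.
Proof.
split.
  case=> -[x [z sep]] nf; have [_ _ [A [B [_ _ AB iAB [Ax Bz]]]]] := sep.
  have [w Kw ew] : Y q by rewrite -AB; left; have : (A `&` B) q; [rewrite iAB|case].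
  have [x' Kx ex] : Y x by rewrite -AB; left.
  have [z' Kz ez] : Y z by rewrite -AB; right.
  rewrite -ew -ex -ez in sep.
  have /separates_vertex[u eu] : separates accordion w x' z'.
    exact: (separates_preimage compact_accordion (@continuous_unfold R sigma)
      (@unfold_accordion_inj R sigma)).
  have [e|[v [j e]]] := word_spine u.
    exists (size u); have qe : q = entry (size u).+1.
      by rewrite -ew -eu e vertex_spine size_nseq unfold_entry.
    by split => // es; apply: nf; rewrite qe; exact: facing_join.
  by exfalso; apply: nf; rewrite -ew -eu e; exact: gap_facing_block.
case=> j [ns ->]; split; last exact: not_facing_join.
exists (arm sigma j false 1 0), (arm sigma j true 1 0); apply: arms_separate.
by rewrite ltr01 lexx.
Qed.

End SpecialPoints.

(** * Coding real numbers *)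

Section Coding.
Context {R : realType}.
Local Arguments scale : simpl never.
Implicit Types (p q : R * R) (i j k m n : nat) (beta gamma : nat -> bool).

Definition between i j k := (i < j < k)%N || (k < j < i)%N.

Lemma spine_vertex_inj i j : vertex (spine i) = vertex (spine j) :> R * R -> i = j.
Proof. by move=> /vertex_inj /(congr1 size); rewrite !size_nseq. Qed.

Lemma entry_inj i j : entry i.+1 = entry j.+1 :> R * R -> i = j.
Proof. by rewrite -!vertex_spine => /spine_vertex_inj. Qed.

(** Consecutive entries lie on opposite sides of one block. The words of the vertices inside it
    contain [false], unlike [spine j], so [bisection] carries the colour from one entry to the
    next. *)
Lemma entries_color A B i j k : splitting A B (@entry R j.+1) -> (i <= k)%N ->
  (j < i)%N || (k < j)%N -> A (entry i.+1) -> A (entry k.+1).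
Proof.
move=> sp /subnK <-; elim: (k - i)%N => [//|n IH] h Ai.
have [hn nj nj'] : [/\ (j < i)%N || (n + i < j)%N, (n + i)%N <> j & (n + i).+1 <> j].
  by case/orP: h => h; split; rewrite ?h ?orbT //; lia.
apply: (@bisection _ A B _ (false :: spine (n + i).+1) (entry (n + i).+1) _ sp) => //.
- move=> v; rewrite -vertex_spine => /vertex_inj e.
  have : false \in spine j by rewrite -e mem_cat inE eqxx orbT.
  by rewrite mem_nseq andbF.
- by rewrite -vertex_spine; exact: (segment_vertex _).2.
- by rewrite -vertex_spine; exact: (segment_vertex _).1.
- by move/entry_inj.
- by move/entry_inj.
- exact: IH.
Qed.

Lemma separates_entries i j k :
  separates accordion (@entry R j.+1) (entry i.+1) (entry k.+1) <-> between i j k.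
Proof.
split.
  case=> ij kj [A [B [cA cB AB iAB [Ai Bk]]]].
  have sp : splitting A B (@entry R j.+1) by [].
  have ni : i <> j by move=> e; apply: ij; rewrite e.
  have nk : k <> j by move=> e; apply: kj; rewrite e.
  rewrite /between; apply: contrapT => nb.
  have [ik|ki] := leqP i k.
    apply: kj; apply: (splitting_eq sp) => //.
    by apply: (entries_color sp ik) => //; lia.
  apply: ij; apply: (splitting_eq sp) => //.
  by apply: (entries_color (splittingC sp) (ltnW ki)) => //; lia.
suff wl a b : (a < j)%N -> (j < b)%N ->
    separates accordion (@entry R j.+1) (entry a.+1) (entry b.+1).
  by case/orP=> /andP[h1 h2]; [apply: wl|apply: separatesC; apply: wl].
move=> aj jb; rewrite -vertex_spine.
have na : a <> j by lia. have nb : b <> j by lia.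
apply: gap_separates; try exact: v_accordion.
- have [hy e] : segment (gap (spine a)).2 (@entry R a.+1).
    by rewrite -vertex_spine; exact: (segment_vertex _).2.
  rewrite e; have := abscissa_le hy (spineS_le (R := R) aj).
  have := abscissa_lt hy (@gap_gt R (spine j)).
  by rewrite -[spine a.+1]/(true :: spine a) quad_cons /=; lra.
- have [hy e] : segment (gap (spine b)).1 (@entry R b.+1).
    by rewrite -vertex_spine; exact: (segment_vertex _).1.
  rewrite e; have := abscissa_le hy (spineS_le (R := R) jb).
  have := abscissa_lt hy (@gap_gt R (spine b)).
  by rewrite -[spine j.+1]/(true :: spine j) quad_cons /=; lra.
- by rewrite -vertex_spine => /spine_vertex_inj.
- by rewrite -vertex_spine => /spine_vertex_inj.
Qed.

Lemma image_separates_entries sigma i j k :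
  separates (unfolded sigma) (@entry R j.+1) (entry i.+1) (entry k.+1) <-> between i j k.
Proof.
split=> [sep|/separates_entries sep].
  apply/separates_entries; apply: (separates_preimage compact_accordion
    (@continuous_unfold R sigma) (@unfold_accordion_inj R sigma));
    by rewrite ?unfold_entry //; exact: v_accordion.
rewrite -(unfold_entry sigma j.+1) -(unfold_entry sigma i.+1) -(unfold_entry sigma k.+1).
by apply: image_separates => //; exact: v_accordion.
Qed.

(** Only 0 is between no two numbers, so it is fixed; then [n] being between 0 and [n.+1] makes both
    maps increasing, and each dominates the identity. *)
Lemma between_id (f g : nat -> nat) : cancel f g -> cancel g f ->
  (forall i j k, between i j k -> between (f i) (f j) (f k)) ->
  (forall i j k, between i j k -> between (g i) (g j) (g k)) -> f =1 id.
Proof.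
have zero (a b : nat -> nat) : cancel a b ->
    (forall i j k, between i j k -> between (b i) (b j) (b k)) -> a 0%N = 0%N.
  move=> ab bb; apply/eqP; rewrite eqn0Ngt; apply/negP => a0.
  by have := bb 0%N (a 0%N) (a 0%N).+1; rewrite ab /between a0 ltnSn /= => /(_ isT); lia.
have mono (a b : nat -> nat) : cancel a b -> a 0%N = 0%N ->
    (forall i j k, between i j k -> between (a i) (a j) (a k)) -> forall n, (n <= a n)%N.
  move=> ab a0 aa; elim=> [//|n IH].
  have [->|n0] := posnP n.
    by rewrite lt0n; apply/eqP => h; have := ab 1%N; rewrite h -a0 ab.
  have : between (a 0%N) (a n) (a n.+1) by apply: aa; rewrite /between n0 ltnSn.
  by rewrite a0 /between; lia.
move=> fg gf ff gg n; have f0 := zero _ _ fg gg; have g0 := zero _ _ gf ff.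
have := mono _ _ fg f0 ff n; have := mono _ _ gf g0 gg (f n); rewrite fg /=; lia.
Qed.

(* Reverses the orientation between consecutive blocks exactly once in each of the
   pairs of joins [2n], [2n+1]: at a V or at a Lambda, according to [beta n]. *)
Definition twists beta m : bool :=
  if odd m && ~~ beta m./2 then ~~ odd m./2 else odd m./2.

(** The index of the join with the n-th change of sign. Join [j] is at [entry j.+1], a V exactly
    when [j] is even, so [beta n = false] selects the V. *)
Definition twist beta n : nat := (n.*2 + beta n)%N.

Lemma twistsP beta j : twists beta j <> twists beta j.+1 <-> exists n, j = twist beta n.
Proof.
rewrite -[j]odd_double_half; set n := j./2; case: (odd j); rewrite ?add1n ?add0n.
  have -> : twists beta n.*2.+1 = if ~~ beta n then ~~ odd n else odd n.
    by rewrite /twists /= odd_double /= uphalf_double.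
  have -> : twists beta n.*2.+2 = ~~ odd n.
    by rewrite -doubleS /twists odd_double doubleK /=.
  split.
    case bn : (beta n) => //= _; exists n; rewrite /twist bn; lia.
  case=> m; rewrite /twist => e; have em : m = n by case: (beta m) e => /=; lia.
  by move: e; rewrite em; case: (beta n) => /=; [case: (odd n)|lia].
have -> : twists beta n.*2 = odd n by rewrite /twists odd_double doubleK.
have -> : twists beta n.*2.+1 = if ~~ beta n then ~~ odd n else odd n.
  by rewrite /twists /= odd_double /= uphalf_double.
split.
  case bn : (beta n) => //= _; exists n; rewrite /twist bn; lia.
case=> m; rewrite /twist => e; have em : m = n by case: (beta m) e => /=; lia.
by move: e; rewrite em; case: (beta n) => /=; [lia|case: (odd n)].
Qed.

Lemma twist_lt beta m n : (twist beta m < twist beta n)%N = (m < n)%N.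
Proof.
rewrite /twist; have [mn|nm|->] := ltngtP m n; last exact: ltnn.
  by case: (beta m); case: (beta n) => /=; lia.
by case: (beta m); case: (beta n) => /=; lia.
Qed.

Lemma between_twist beta i j k :
  between (twist beta i) (twist beta j) (twist beta k) = between i j k.
Proof. by rewrite /between !twist_lt. Qed.

Definition apex_point beta n : R * R := entry (twist beta n).+1.

Lemma apex_point_inj beta : injective (apex_point beta).
Proof.
move=> m n /entry_inj e; have := twist_lt beta m n; have := twist_lt beta n m.
by rewrite e ltnn; lia.
Qed.

Lemma special_apex_point beta q :
  special (unfolded (twists beta)) q <-> exists n, q = apex_point beta n.
Proof.
rewrite specialE; split.
  by case=> j [/twistsP[n ->] ->]; exists n.
by case=> n ->; exists (twist beta n); split => //; apply/twistsP; exists n.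
Qed.

Lemma apex_point_separates beta i j k :
  separates (unfolded (twists beta)) (apex_point beta j) (apex_point beta i)
    (apex_point beta k) <-> between i j k.
Proof. by rewrite image_separates_entries between_twist. Qed.

Lemma homeo_apex_point (h g : R * R -> R * R) beta gamma n :
  cancel h g -> cancel g h -> continuous h -> continuous g ->
  h @` unfolded (twists beta) = unfolded (twists gamma) ->
  h (apex_point beta n) = apex_point gamma n.
Proof.
have ex (a b : R * R -> R * R) be ga : cancel a b -> cancel b a -> continuous a ->
    continuous b -> a @` unfolded (twists be) = unfolded (twists ga) ->
    exists f : nat -> nat, (forall m, a (apex_point be m) = apex_point ga (f m)) /\
      forall i j k, between i j k -> between (f i) (f j) (f k).
  move=> ab ba ca cb e.
  have step m : exists m', a (apex_point be m) = apex_point ga m'.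
    apply/special_apex_point; rewrite -e; apply: (special_homeo ab ba ca cb).
    by apply/special_apex_point; exists m.
  have [f fP] := choice step.
  exists f; split => // i j k /(apex_point_separates be) /(separates_homeo ab ba cb).
  by rewrite e !fP => /apex_point_separates.
move=> hg gh ch cg e.
have [f [fP fb]] := ex h g beta gamma hg gh ch cg e.
have e' : g @` unfolded (twists gamma) = unfolded (twists beta).
  rewrite -e; apply/seteqP; split => y.
    by case=> _ [x Yx <-] <-; rewrite hg.
  by move=> Yy; exists (h y); [exists y|rewrite hg].
have [f' [f'P f'b]] := ex g h gamma beta gh hg cg ch e'.
have ff' : cancel f f'.
  by move=> m; apply: (@apex_point_inj beta); rewrite -f'P -fP hg.
have f'f : cancel f' f.
  by move=> m; apply: (@apex_point_inj gamma); rewrite -fP -f'P gh.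
by rewrite fP (between_id ff' f'f fb f'b).
Qed.

Lemma apex_point_cvg beta (b : bool) (N : set (R * R)) : nbhs (1 : R, b%:R : R) N ->
  exists m, forall n, (m <= n)%N -> beta n = b -> N (apex_point beta n).
Proof.
move=> /nbhs_ballP[e /= e0 he]; have [m hm] := expr_half_lt e0; exists m => n mn bn.
apply: he; split; rewrite /ball /=.
  have s0 := @scale_gt0 R (twist beta n).+1; have := @scale_le R (twist beta n).+1.
  have : (2^-1 : R) ^+ (twist beta n).+1 <= 2^-1 ^+ m.
    by apply: ler_wiXn2l; [lra|lra|rewrite /twist; lia].
  by rewrite ger0_norm; lra.
suff -> : hgt (twist beta n).+1 0 = b%:R :> R by rewrite subrr normr0.
rewrite /hgt /= /twist oddD odd_double bn.
by case: (b) => /=; lra.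
Qed.

(** Along the indices where the codes take the values [b] and [c], the points [apex_point gamma n]
    accumulate both at [h (1, b)], by continuity, and at [(1, c)]. *)
Lemma homeo_limit (h g : R * R -> R * R) beta gamma (b c : bool) :
  cancel h g -> cancel g h -> continuous h -> continuous g ->
  h @` unfolded (twists beta) = unfolded (twists gamma) ->
  (forall m, exists n, [/\ (m <= n)%N, beta n = b & gamma n = c]) ->
  h (1, b%:R) = (1, c%:R).
Proof.
move=> hg gh ch cg e inf; apply: (@norm_hausdorff _ (R * R)%type) => A B hA hB.
have [m1 h1] := apex_point_cvg beta (ch _ _ hA).
have [m2 h2] := apex_point_cvg gamma hB.
have [n [mn bn cn]] := inf (maxn m1 m2).
exists (apex_point gamma n); split; last by apply: h2 => //; lia.
rewrite -(homeo_apex_point n hg gh ch cg e); apply: h1 => //; lia.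
Qed.

(* Each rational cut by [r] is recorded infinitely often, at odd positions. *)
Definition cut_code (r : R) n : bool :=
  if odd n then oapp (fun q : rat => ratr q < r) false (unpickle (logn 2 n./2)) else false.

Lemma cut_code_rat (q : rat) m : exists n, (m <= n)%N /\
  forall r : R, cut_code r n = (ratr q < r).
Proof.
(* The power of 2 encodes [q], read back by [logn 2]; the odd factor [3 ^ m] makes the position as
   large as desired. *)
have xm : (m <= 2 ^ pickle q * 3 ^ m)%N.
  have h1 : (m < 3 ^ m)%N by apply: ltn_expl.
  by apply: (leq_trans (ltnW h1)); rewrite leq_pmull // expn_gt0.
have xq : logn 2 (2 ^ pickle q * 3 ^ m) = pickle q.
  by rewrite lognM ?expn_gt0 // pfactorK // lognX muln0 addn0.
move: (2 ^ _ * _)%N xm xq => x xm xq; exists x.*2.+1; split.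
  by rewrite ltnW // ltnS -addnn (leq_trans xm) ?leq_addr.
by move=> r; rewrite /cut_code oddS odd_double (half_bit_double x true) xq pickleK.
Qed.

Lemma cut_code_homeo (h g : R * R -> R * R) (r s : R) :
  cancel h g -> cancel g h -> continuous h -> continuous g ->
  h @` unfolded (twists (cut_code r)) = unfolded (twists (cut_code s)) -> r = s.
Proof.
move=> hg gh ch cg e.
(* Every code is [false] at the even positions, which provides the infinitely many common V's. *)
have h0 : h (1, false%:R) = (1, false%:R).
  apply: (homeo_limit hg gh ch cg e) => m; exists m.*2.
  by rewrite /cut_code odd_double; split => //; lia.
have [rs|sr|//] := ltgtP r s; exfalso.
  have [q /andP[rq qs]] : exists q : rat, r < ratr q < s.
    by have [q] := rat_in_itvoo rs; rewrite in_itv /=; exists q.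
  have : h (1, false%:R) = (1, true%:R).
    apply: (homeo_limit hg gh ch cg e) => m; have [n [mn hn]] := cut_code_rat q m.
    by exists n; rewrite !hn qs ltNge ltW.
  by rewrite h0 => -[/eqP]; rewrite eq_sym oner_eq0.
have [q /andP[sq qr]] : exists q : rat, s < ratr q < r.
  by have [q] := rat_in_itvoo sr; rewrite in_itv /=; exists q.
have : h (1, true%:R) = (1, false%:R).
  apply: (homeo_limit hg gh ch cg e) => m; have [n [mn hn]] := cut_code_rat q m.
  by exists n; rewrite !hn qr ltNge ltW.
by rewrite -h0 => /(can_inj hg) -[/eqP]; rewrite oner_eq0.
Qed.

Definition embedding (r : R) (t : set_type (knaster_accordion R)) : R * R :=
  unfold (twists (cut_code r)) (val t).

Lemma range_embedding r : range (embedding r) = unfolded (twists (cut_code r)).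
Proof.
apply/seteqP; split.
  move=> _ [t _ <-]; exists (val t) => //.
  by rewrite -knaster_accordionE; apply: set_mem; exact: valP.
move=> _ [p Kp <-]; rewrite -knaster_accordionE in Kp.
by exists (exist _ p (mem_set Kp)).
Qed.

Lemma planar_embedding_embedding r : planar_embedding (embedding r).
Proof.
apply: (@planar_embedding_compact _ (knaster_accordion R) (unfold (twists (cut_code r)))).
- rewrite knaster_accordionE; exact: compact_accordion.
- rewrite knaster_accordionE; exact: continuous_unfold.
- rewrite knaster_accordionE; exact: unfold_accordion_inj.
Qed.

Lemma embedding_equivalent r s :
  equivalent_embeddings (embedding r) (embedding s) -> r = s.
Proof.
case=> h [g [hg gh ch cg]]; rewrite !range_embedding => e.
exact: (cut_code_homeo hg gh ch cg e).
Qed.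

End Coding.

Local Open Scope card_scope.

Theorem theorem2p3 (R : realType) :
  exists Phi : set (set_type (knaster_accordion R) -> R * R),
    [/\ Phi #= [set: R],
        (forall phi, Phi phi -> planar_embedding phi)
      & (forall phi psi, Phi phi -> Phi psi -> phi <> psi ->
           ~ equivalent_embeddings phi psi)].
Proof.
exists (range (@embedding R)); split.
(* Equal embeddings are equivalent through the identity, so inequivalence already yields injectivity
   in [r]. *)
- apply: inj_card_eq => r s _ _ e; apply: embedding_equivalent; rewrite e.
  by exists id; [exists id; split => // ? ?|rewrite image_id].
- by move=> _ [r _ <-]; exact: planar_embedding_embedding.
- move=> _ _ [r _ <-] [s _ <-] ne /embedding_equivalent e.
  by apply: ne; rewrite e.
Qed.
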